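(* Let $R>0$, let $B=B(0,R)\subset\mathbb{H}$, and let $f : B \to \mathbb{H}$ be a regular function. If $|f|$ has a local minimum point $p=x+yI\in B$ (with $x,y\in\mathbb{R}$, $I\in\mathbb{S}$), then either $f$ is constant or $f$ has a zero in $x+y\mathbb{S}$.
   Context: $\mathbb{H}$ is the skew field of real quaternions, with the usual norm $|\cdot|$, and $B(0,R)=\{q\in\mathbb{H}:|q|<R\}$. Let $\mathbb{S}=\{q\in\mathbb{H}:q^2=-1\}$ be the 2-sphere of imaginary units and, for $I\in\mathbb{S}$, let $L_I=\mathbb{R}+I\mathbb{R}$. A real differentiable function $f:\Omega\to\mathbb{H}$ on a domain $\Omega\subseteq\mathbb{H}$ is called regular (Cullen-regular) if for every $I\in\mathbb{S}$ the restriction $f_I$ of $f$ to $\Omega\cap L_I$ satisfies $\frac12\left(\frac{\partial}{\partial x}+I\frac{\partial}{\partial y}\right)f_I(x+Iy)=0$ at every point $x+Iy$ of $\Omega\cap L_I$ ($x,y\in\mathbb{R}$). For $x,y\in\mathbb{R}$ write $x+y\mathbb{S}=\{x+yI:I\in\mathbb{S}\}$. *)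

(* Defs.v *)
From Stdlib Require Import Reals Lra.
From Coquelicot Require Import Coquelicot.
Open Scope R_scope.

(* [(a, b, c, d)] stands for a + b i + c j + d k.  Sums, opposites, real
   scalings, topology and differentiability are those of the iterated product
   normed module over R. *)
Definition quat : Type := (R * R * R * R)%type.

Definition RtoQ (a : R) : quat := (a, 0, 0, 0).

Definition qmult (p q : quat) : quat :=
  let '(a1, b1, c1, d1) := p in
  let '(a2, b2, c2, d2) := q in
  (a1 * a2 - b1 * b2 - c1 * c2 - d1 * d2,
   a1 * b2 + b1 * a2 + c1 * d2 - d1 * c2,
   a1 * c2 - b1 * d2 + c1 * a2 + d1 * b2,
   a1 * d2 + b1 * c2 - c1 * b2 + d1 * a2).

Definition qnorm (q : quat) : R :=
  let '(a, b, c, d) := q in sqrt (a ^ 2 + b ^ 2 + c ^ 2 + d ^ 2).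

Definition qball (r : R) (q : quat) : Prop := qnorm q < r.

Definition imag_unit (I : quat) : Prop := qmult I I = opp (RtoQ 1).

(* x + y I *)
Definition slice_pt (I : quat) (x y : R) : quat := plus (RtoQ x) (scal y I).

(* x + y S, where S is the set of imaginary units *)
Definition qsphere (x y : R) (q : quat) : Prop :=
  exists I : quat, imag_unit I /\ q = slice_pt I x y.

(* Cullen-regularity on an open set [Omega]; [f] is a total function whose
   values outside [Omega] are irrelevant.  The factor I of the operator
   (d/dx + I d/dy) / 2 acts by multiplication on the left. *)
Definition regular (Omega : quat -> Prop) (f : quat -> quat) : Prop :=
  (forall q : quat, Omega q -> ex_filterdiff f (locally q)) /\
  (forall I : quat, imag_unit I ->
   forall x y : R, Omega (slice_pt I x y) ->
   exists fx fy : quat,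
     is_derive (fun t : R => f (slice_pt I t y)) x fx /\
     is_derive (fun t : R => f (slice_pt I x t)) y fy /\
     scal (1 / 2) (plus fx (qmult I fy)) = zero).

(* Main.v *)
Require Import Defs.
From Stdlib Require Import Reals Lra Lia Classical ClassicalEpsilon.
From Coquelicot Require Import Coquelicot.
Open Scope R_scope.

(** The proof passes to the stem function of f. On a ball centred at 0, a
    regular function has the form f(x + y K) = b(x, y) + K c(x, y) for every
    imaginary unit K, with b and c not depending on K and b + i c holomorphic
    with values in the complexified quaternions ([representation_formula]).
    The product of b + i c with its quaternionic conjugate is a complex
    holomorphic function, the symmetrization f^s; it vanishes at x + i y
    exactly when f has a zero on the sphere x + y S ([symm_zero_root]).

    Suppose then that f has no zero on that sphere, so that f^s is nonzero
    near it, and consider the regular reciprocal g = f^c / f^s, where f^c has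
    the stem of conjugates. On the slice of a unit K its norm is
    |g(x + y K)| = 1 / |f(x + y J)|, where J is the conjugate of K by
    f^c(x + y K) ([conj_stem_mult_value]). The unit J varies continuously
    with the point, and K can be chosen so that J = I at the minimum point
    ([conj_stem_intertwines]). Hence |g|, restricted to one slice, has a local
    maximum, and the maximum principle makes g constant there
    ([reciprocal_locally_constant]). The identity theorem carries the relation
    f^c = f^s a to the whole ball, and it forces f^s, then f, to be constant
    ([constant_of_constant_reciprocal]).

    The complex analysis is developed from differentiability alone, since
    regular functions are not assumed to be of class C^1. Goursat's bisection
    argument proves Green's theorem for closed forms on rectangles
    ([green_closed_form]). Applied in polar coordinates it yields the mean
    value property ([mean_value]), from which the maximum principle
    ([holo_re_max]) and the identity theorem ([holo_identity]) follow without
    power series. A function vanishing on the real diameter is treated by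
    cutting it off to zero on half of the disc ([holo_zero_of_axis]). *)

(** * Bisection of rectangles *)

Lemma nested_intervals (a b : nat -> R) :
  (forall n, a n <= a (S n)) -> (forall n, b (S n) <= b n) ->
  (forall n, a n <= b n) ->
  exists x, forall n, a n <= x <= b n.
Proof.
intros Ha Hb Hab.
assert (Ha' : forall n k, a n <= a (n + k)%nat).
{ intros n k; induction k as [|k IH].
  - rewrite Nat.add_0_r; lra.
  - rewrite Nat.add_succ_r; generalize (Ha (n + k)%nat); lra. }
assert (Hb' : forall n k, b (n + k)%nat <= b n).
{ intros n k; induction k as [|k IH].
  - rewrite Nat.add_0_r; lra.
  - rewrite Nat.add_succ_r; generalize (Hb (n + k)%nat); lra. }
assert (Hnm : forall n m, a n <= b m).
{ intros n m.
  generalize (Ha' n m) (Hb' m n) (Hab (n + m)%nat).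
  rewrite (Nat.add_comm m n); lra. }
destruct (completeness (fun x => exists n, x = a n)) as [x [Hub Hlub]].
- exists (b O); intros z [n ->]; apply Hnm.
- exists (a O), O; reflexivity.
- exists x; intros n; split.
  + apply Hub; exists n; reflexivity.
  + apply Hlub; intros z [m ->]; apply Hnm.
Qed.

(** A bad rectangle would have a bad quarter, whose quarters would again
    include a bad one, and so on; these nested bad rectangles shrink to a
    point, around which small rectangles are good. *)
Lemma rectangle_bisection (good : R -> R -> R -> R -> Prop) (A B C D : R) :
  A <= B -> C <= D ->
  (forall a b c d, A <= a <= b -> b <= B -> C <= c <= d -> d <= D ->
     good a ((a + b) / 2) c ((c + d) / 2) ->
     good ((a + b) / 2) b c ((c + d) / 2) ->
     good a ((a + b) / 2) ((c + d) / 2) d ->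
     good ((a + b) / 2) b ((c + d) / 2) d -> good a b c d) ->
  (forall x y, A <= x <= B -> C <= y <= D ->
     exists delta, 0 < delta /\
     forall a b c d, A <= a <= x -> x <= b <= B -> C <= c <= y -> y <= d <= D ->
       b - a < delta -> d - c < delta -> good a b c d) ->
  good A B C D.
Proof.
intros HAB HCD Hquart Hloc.
apply NNPP; intros Hbad.
pose (step := fun q : (R * R) * (R * R) =>
  let '((a, b), (c, d)) := q in
  let m := (a + b) / 2 in let n := (c + d) / 2 in
  if excluded_middle_informative (good a m c n) then
  if excluded_middle_informative (good m b c n) then
  if excluded_middle_informative (good a m n d) then ((m, b), (n, d))
  else ((a, m), (n, d)) else ((m, b), (c, n)) else ((a, m), (c, n))).
pose (q := fun n => Nat.iter n step ((A, B), (C, D))).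
pose (a := fun n => fst (fst (q n))). pose (b := fun n => snd (fst (q n))).
pose (c := fun n => fst (snd (q n))). pose (d := fun n => snd (snd (q n))).
assert (Hinv : forall n, (A <= a n <= b n /\ b n <= B /\ C <= c n <= d n /\ d n <= D)
   /\ ~ good (a n) (b n) (c n) (d n)
   /\ b n - a n = (B - A) / 2 ^ n /\ d n - c n = (D - C) / 2 ^ n).
{ induction n as [|n IH].
  - unfold a, b, c, d, q; simpl; repeat split; try lra; exact Hbad.
  - unfold a, b, c, d in *; unfold q in *; simpl.
    destruct (Nat.iter n step (A, B, (C, D))) as [[a0 b0] [c0 d0]]; simpl in *.
    destruct IH as [[H1 [H2 [H3 H4]]] [H5 [H6 H7]]].
    assert (E1 : (B - A) / (2 * 2 ^ n) = (b0 - a0) / 2).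
    { rewrite H6; field; apply pow_nonzero; lra. }
    assert (E2 : (D - C) / (2 * 2 ^ n) = (d0 - c0) / 2).
    { rewrite H7; field; apply pow_nonzero; lra. }
    rewrite E1, E2; clear E1 E2.
    specialize (Hquart a0 b0 c0 d0 H1 H2 H3 H4).
    repeat destruct excluded_middle_informative; simpl; repeat split; try lra; tauto. }
assert (Hstep : forall n, a n <= a (S n) /\ b (S n) <= b n /\ c n <= c (S n) /\ d (S n) <= d n).
{ intros n. destruct (Hinv n) as [[H1 [H2 [H3 H4]]] _].
  unfold a, b, c, d, q in *; simpl.
  destruct (Nat.iter n step (A, B, (C, D))) as [[a0 b0] [c0 d0]]; simpl in *.
  repeat destruct excluded_middle_informative; simpl; lra. }
destruct (nested_intervals a b) as [x Hx]; try (intros n; generalize (Hstep n) (Hinv n); tauto).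
destruct (nested_intervals c d) as [y Hy]; try (intros n; generalize (Hstep n) (Hinv n); tauto).
destruct (Hloc x y) as [delta [Hd Hgood]].
{ generalize (Hx O) (Hinv O); lra. } { generalize (Hy O) (Hinv O); lra. }
assert (HN : exists n, (B - A) / 2 ^ n < delta /\ (D - C) / 2 ^ n < delta).
{ set (M := (B - A) + (D - C) + 1).
  destruct (pow_lt_1_zero (1 / 2)) with (y := delta / M) as [n Hn].
  { rewrite Rabs_pos_eq; lra. }
  { apply Rdiv_lt_0_compat; unfold M; lra. }
  exists n. specialize (Hn n (Nat.le_refl _)).
  rewrite Rabs_pos_eq in Hn by (apply pow_le; lra).
  unfold Rdiv at 1 in Hn; rewrite Rmult_1_l in Hn; rewrite pow_inv in Hn.
  assert (Hp : 0 < / 2 ^ n) by (apply Rinv_0_lt_compat, pow_lt; lra).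
  assert (HM : M * / 2 ^ n < delta).
  { apply Rmult_lt_reg_r with (/ M); [apply Rinv_0_lt_compat; unfold M; lra|].
    replace (M * / 2 ^ n * / M) with (/ 2 ^ n); [exact Hn|].
    field; split; [unfold M; lra | apply pow_nonzero; lra]. }
  unfold Rdiv; split; apply Rle_lt_trans with (2 := HM);
    apply Rmult_le_compat_r; unfold M; lra. }
destruct HN as [n [Hn1 Hn2]].
destruct (Hinv n) as [[H1 [H2 [H3 H4]]] [H5 [H6 H7]]].
apply H5, Hgood; generalize (Hx n) (Hy n); lra.
Qed.

(** * Closed forms on rectangles without continuity of the derivative *)

(** The integral of P dx + Q dy along the boundary of the rectangle from (a,
    c) to (b, d), counterclockwise. *)
Definition circulation (P Q : R -> R -> R) (a b c d : R) : R :=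
  RInt (fun x => P x c) a b + RInt (fun y => Q b y) c d
  - RInt (fun x => P x d) a b - RInt (fun y => Q a y) c d.

Lemma continuity_2d_pt_slice_x (f : R -> R -> R) x y :
  continuity_2d_pt f x y -> continuous (fun t => f t y) x.
Proof.
intros H. apply continuity_pt_filterlim. intros eps Heps.
destruct (H (mkposreal eps Heps)) as [d Hd].
exists d; split; [apply cond_pos|].
intros z [_ Hz]. apply Hd; [exact Hz|].
rewrite Rminus_diag, Rabs_R0; apply cond_pos.
Qed.

Lemma continuity_2d_pt_slice_y (f : R -> R -> R) x y :
  continuity_2d_pt f x y -> continuous (fun t => f x t) y.
Proof.
intros H. apply continuity_pt_filterlim. intros eps Heps.
destruct (H (mkposreal eps Heps)) as [d Hd].
exists d; split; [apply cond_pos|].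
intros z [_ Hz]. apply Hd; [|exact Hz].
rewrite Rminus_diag, Rabs_R0; apply cond_pos.
Qed.

Lemma ex_RInt_slice_x (f : R -> R -> R) a b y :
  (forall x, Rmin a b <= x <= Rmax a b -> continuity_2d_pt f x y) ->
  ex_RInt (fun t => f t y) a b.
Proof.
intros H; apply (ex_RInt_continuous (V := R_CompleteNormedModule)).
intros z Hz; apply continuity_2d_pt_slice_x, H, Hz.
Qed.

Lemma ex_RInt_slice_y (f : R -> R -> R) c d x :
  (forall y, Rmin c d <= y <= Rmax c d -> continuity_2d_pt f x y) ->
  ex_RInt (fun t => f x t) c d.
Proof.
intros H; apply (ex_RInt_continuous (V := R_CompleteNormedModule)).
intros z Hz; apply continuity_2d_pt_slice_y, H, Hz.
Qed.

Lemma RInt_near_constant (f : R -> R) a b k e :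
  a <= b -> ex_RInt f a b ->
  (forall t, a <= t <= b -> Rabs (f t - k) <= e) ->
  Rabs (RInt f a b - (b - a) * k) <= (b - a) * e.
Proof.
intros Hab Hf He.
replace (RInt f a b - (b - a) * k) with (RInt (fun t => f t - k) a b).
- apply abs_RInt_le_const; auto.
  apply (ex_RInt_minus (V := R_NormedModule)); [exact Hf | apply ex_RInt_const].
- rewrite (RInt_minus (V := R_CompleteNormedModule)); [|exact Hf|apply ex_RInt_const].
  rewrite RInt_const; reflexivity.
Qed.

(** The affine parts of P and Q at the point contribute nothing, because their
    mixed derivatives agree. The remainders are o(size) along a boundary of
    length O(size), so the circulation is o(size^2): exactly the order that
    survives summation over the 4^n rectangles of a subdivision. *)
Lemma circulation_local (P Q : R -> R -> R) x y px l qy eps :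
  differentiable_pt_lim P x y px l -> differentiable_pt_lim Q x y l qy ->
  0 < eps ->
  exists delta, 0 < delta /\
  forall a b c d, a <= x <= b -> c <= y <= d -> b - a < delta -> d - c < delta ->
    (forall u v, a <= u <= b -> c <= v <= d ->
       continuity_2d_pt P u v /\ continuity_2d_pt Q u v) ->
    Rabs (circulation P Q a b c d) <= eps * ((b - a) + (d - c)) ^ 2.
Proof.
intros HP HQ Heps.
assert (He : 0 < eps / 2) by lra.
destruct (HP (mkposreal _ He)) as [d1 H1].
destruct (HQ (mkposreal _ He)) as [d2 H2].
exists (Rmin d1 d2); split; [apply Rmin_pos; apply cond_pos|].
intros a b c d Hx Hy Hba Hdc Hcont.
assert (Hd1 := Rmin_l d1 d2). assert (Hd2 := Rmin_r d1 d2).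
set (L := (b - a) + (d - c)).
assert (Hmax : forall u v, a <= u <= b -> c <= v <= d ->
  Rmax (Rabs (u - x)) (Rabs (v - y)) <= L).
{ intros u v Hu Hv; unfold L; apply Rmax_lub; apply Rabs_le; lra. }
assert (H1' : forall u v, a <= u <= b -> c <= v <= d ->
  Rabs (P u v - P x y - (px * (u - x) + l * (v - y))) <= eps / 2 * L).
{ intros u v Hu Hv; eapply Rle_trans; [apply H1; apply Rabs_def1; lra|].
  apply Rmult_le_compat_l; simpl; [lra | apply Hmax; assumption]. }
assert (H2' : forall u v, a <= u <= b -> c <= v <= d ->
  Rabs (Q u v - Q x y - (l * (u - x) + qy * (v - y))) <= eps / 2 * L).
{ intros u v Hu Hv; eapply Rle_trans; [apply H2; apply Rabs_def1; lra|].
  apply Rmult_le_compat_l; simpl; [lra | apply Hmax; assumption]. }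
assert (exP : forall v, c <= v <= d -> ex_RInt (fun u => P u v) a b).
{ intros v Hv; apply ex_RInt_slice_x; intros u Hu.
  rewrite Rmin_left, Rmax_right in Hu by lra; apply Hcont; lra. }
assert (exQ : forall u, a <= u <= b -> ex_RInt (fun v => Q u v) c d).
{ intros u Hu; apply ex_RInt_slice_y; intros v Hv.
  rewrite Rmin_left, Rmax_right in Hv by lra; apply Hcont; lra. }
assert (EP : Rabs (RInt (fun u => P u c - P u d) a b - (b - a) * (l * (c - d)))
  <= (b - a) * (eps * L)).
{ apply RInt_near_constant; [lra| |].
  - apply (ex_RInt_minus (V := R_NormedModule)); apply exP; lra.
  - intros u Hu. assert (K1 := H1' u c Hu ltac:(lra)). assert (K2 := H1' u d Hu ltac:(lra)).
    apply Rabs_le. apply Rabs_le_between in K1, K2; lra. }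
assert (EQ : Rabs (RInt (fun v => Q b v - Q a v) c d - (d - c) * (l * (b - a)))
  <= (d - c) * (eps * L)).
{ apply RInt_near_constant; [lra| |].
  - apply (ex_RInt_minus (V := R_NormedModule)); apply exQ; lra.
  - intros v Hv. assert (K1 := H2' b v ltac:(lra) Hv). assert (K2 := H2' a v ltac:(lra) Hv).
    apply Rabs_le. apply Rabs_le_between in K1, K2; lra. }
rewrite (RInt_minus (V := R_CompleteNormedModule)) in EP by (apply exP; lra).
rewrite (RInt_minus (V := R_CompleteNormedModule)) in EQ by (apply exQ; lra).
change (Rabs (RInt (fun u => P u c) a b - RInt (fun u => P u d) a b
  - (b - a) * (l * (c - d))) <= (b - a) * (eps * L)) in EP.
change (Rabs (RInt (fun v => Q b v) c d - RInt (fun v => Q a v) c d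
  - (d - c) * (l * (b - a))) <= (d - c) * (eps * L)) in EQ.
unfold circulation.
apply Rabs_le_between in EP, EQ. apply Rabs_le.
replace (eps * L ^ 2) with ((b - a) * (eps * L) + (d - c) * (eps * L)) by (unfold L; ring).
lra.
Qed.

Lemma circulation_quarter (P Q : R -> R -> R) a b c d m n :
  a <= m <= b -> c <= n <= d ->
  (forall u v, a <= u <= b -> c <= v <= d ->
     continuity_2d_pt P u v /\ continuity_2d_pt Q u v) ->
  circulation P Q a b c d =
  circulation P Q a m c n + circulation P Q m b c n
  + circulation P Q a m n d + circulation P Q m b n d.
Proof.
intros Hm Hn Hcont.
assert (exP : forall v p q, c <= v <= d -> a <= p <= q -> q <= b ->
  ex_RInt (fun u => P u v) p q).
{ intros v p q Hv Hp Hq; apply ex_RInt_slice_x; intros u Hu.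
  rewrite Rmin_left, Rmax_right in Hu by lra; apply Hcont; lra. }
assert (exQ : forall u p q, a <= u <= b -> c <= p <= q -> q <= d ->
  ex_RInt (fun v => Q u v) p q).
{ intros u p q Hu Hp Hq; apply ex_RInt_slice_y; intros v Hv.
  rewrite Rmin_left, Rmax_right in Hv by lra; apply Hcont; lra. }
unfold circulation.
rewrite <- (RInt_Chasles (V := R_CompleteNormedModule) (fun x => P x c) a m b) by (apply exP; lra).
rewrite <- (RInt_Chasles (V := R_CompleteNormedModule) (fun x => P x d) a m b) by (apply exP; lra).
rewrite <- (RInt_Chasles (V := R_CompleteNormedModule) (fun y => Q a y) c n d) by (apply exQ; lra).
rewrite <- (RInt_Chasles (V := R_CompleteNormedModule) (fun y => Q b y) c n d) by (apply exQ; lra).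
unfold plus; simpl; ring.
Qed.

(** Goursat's version of the closed form theorem: the partial derivatives need
    not be continuous. This matters because regularity only provides
    differentiability at each point. *)
Theorem green_closed_form (P Q : R -> R -> R) A B C D :
  A <= B -> C <= D ->
  (forall x y, A <= x <= B -> C <= y <= D ->
     exists px l qy, differentiable_pt_lim P x y px l /\ differentiable_pt_lim Q x y l qy) ->
  circulation P Q A B C D = 0.
Proof.
intros HAB HCD Hd.
assert (Hcont : forall u v, A <= u <= B -> C <= v <= D ->
  continuity_2d_pt P u v /\ continuity_2d_pt Q u v).
{ intros u v Hu Hv; destruct (Hd u v Hu Hv) as (px & l & qy & H1 & H2).
  split; apply differentiable_continuity_pt; [exists px, l | exists l, qy]; assumption. }
set (S := ((B - A) + (D - C)) ^ 2).
assert (HS : 0 <= S) by apply pow2_ge_0.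
assert (Hle : forall eps, 0 < eps -> Rabs (circulation P Q A B C D) <= eps * S).
{ intros eps Heps.
  refine (rectangle_bisection
    (fun a b c d => Rabs (circulation P Q a b c d) <= eps * ((b - a) + (d - c)) ^ 2)
    A B C D HAB HCD _ _).
  - intros a b c d Ha Hb Hc Hd' G1 G2 G3 G4.
    rewrite (circulation_quarter P Q a b c d ((a + b) / 2) ((c + d) / 2)) by
      (try lra; intros; apply Hcont; lra).
    apply Rabs_le_between in G1, G2, G3, G4. apply Rabs_le.
    replace (eps * (b - a + (d - c)) ^ 2) with
     (eps * ((a + b) / 2 - a + ((c + d) / 2 - c)) ^ 2
      + eps * (b - (a + b) / 2 + ((c + d) / 2 - c)) ^ 2
      + eps * ((a + b) / 2 - a + (d - (c + d) / 2)) ^ 2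
      + eps * (b - (a + b) / 2 + (d - (c + d) / 2)) ^ 2) by field.
    lra.
  - intros x y Hx Hy; destruct (Hd x y Hx Hy) as (px & l & qy & H1 & H2).
    destruct (circulation_local P Q x y px l qy eps H1 H2 Heps) as [delta [Hdelta H]].
    exists delta; split; [assumption|].
    intros a b c d Ha Hb Hc Hd' Hba Hdc; apply H; try lra.
    intros; apply Hcont; lra. }
apply NNPP; intros Hne.
assert (Hpos := Rabs_pos_lt _ Hne).
specialize (Hle (Rabs (circulation P Q A B C D) / (2 * (S + 1)))).
assert (H : Rabs (circulation P Q A B C D) / (2 * (S + 1)) * S
  < Rabs (circulation P Q A B C D)).
{ apply Rmult_lt_reg_r with (2 * (S + 1)); [lra|].
  unfold Rdiv; rewrite Rmult_assoc, (Rmult_comm S), <- Rmult_assoc.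
  rewrite (Rmult_assoc _ (/ _) _), Rinv_l by lra. nra. }
assert (0 < Rabs (circulation P Q A B C D) / (2 * (S + 1)))
  by (apply Rdiv_lt_0_compat; lra).
specialize (Hle H0); lra.
Qed.

(** * Differentials of functions of two real variables *)

Lemma diff2_const k x y : differentiable_pt_lim (fun _ _ => k) x y 0 0.
Proof.
intros eps; exists (mkposreal 1 Rlt_0_1); intros u v _ _.
replace (k - k - (0 * (u - x) + 0 * (v - y))) with 0 by ring.
rewrite Rabs_R0; apply Rmult_le_pos; [apply Rlt_le, cond_pos|].
apply Rle_trans with (2 := Rmax_l _ _), Rabs_pos.
Qed.

Lemma diff2_affine a b k x y :
  differentiable_pt_lim (fun u v => a * u + b * v + k) x y a b.
Proof.
intros eps; exists (mkposreal 1 Rlt_0_1); intros u v _ _.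
replace (a * u + b * v + k - (a * x + b * y + k) - (a * (u - x) + b * (v - y)))
  with 0 by ring.
rewrite Rabs_R0; apply Rmult_le_pos; [apply Rlt_le, cond_pos|].
apply Rle_trans with (2 := Rmax_l _ _), Rabs_pos.
Qed.

Lemma diff2_eq f x y a b a' b' :
  differentiable_pt_lim f x y a b -> a = a' -> b = b' ->
  differentiable_pt_lim f x y a' b'.
Proof. intros H -> ->; exact H. Qed.

Lemma diff2_ext f g x y a b :
  differentiable_pt_lim f x y a b -> (forall u v, f u v = g u v) ->
  differentiable_pt_lim g x y a b.
Proof.
intros H E; apply differentiable_pt_lim_ext with (2 := H).
apply locally_2d_forall, E.
Qed.

Lemma diff2_lincomb al be f g x y fx fy gx gy :
  differentiable_pt_lim f x y fx fy -> differentiable_pt_lim g x y gx gy ->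
  differentiable_pt_lim (fun u v => al * f u v + be * g u v) x y
    (al * fx + be * gx) (al * fy + be * gy).
Proof.
intros Hf Hg.
apply diff2_ext with (fun u v => al * f u v + be * g u v + 0); [|intros; ring].
exact (differentiable_pt_lim_comp (fun a b => al * a + be * b + 0) f g x y
  al be fx fy gx gy (diff2_affine _ _ _ _ _) Hf Hg).
Qed.

Lemma diff2_mult f g x y fx fy gx gy :
  differentiable_pt_lim f x y fx fy -> differentiable_pt_lim g x y gx gy ->
  differentiable_pt_lim (fun u v => f u v * g u v) x y
    (g x y * fx + f x y * gx) (g x y * fy + f x y * gy).
Proof.
intros Hf Hg.
apply (differentiable_pt_lim_comp (fun a b => a * b)); try assumption.
intros eps; exists eps; intros u v Hu Hv.
replace (u * v - f x y * g x y - (g x y * (u - f x y) + f x y * (v - g x y)))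
  with ((u - f x y) * (v - g x y)) by ring.
rewrite Rabs_mult.
apply Rmult_le_compat; try apply Rabs_pos; [lra | apply Rmax_r].
Qed.

Lemma diff2_comp1 (h : R -> R) f x y fx fy l :
  derivable_pt_lim h (f x y) l -> differentiable_pt_lim f x y fx fy ->
  differentiable_pt_lim (fun u v => h (f u v)) x y (l * fx) (l * fy).
Proof.
intros Hh Hf.
eapply diff2_eq.
- exact (differentiable_pt_lim_comp (fun a _ => h a) f f x y l 0 _ _ _ _
    (differentiable_pt_lim_proj1_0 h (f x y) (f x y) l Hh) Hf Hf).
- ring.
- ring.
Qed.

Lemma diff2_inv f x y fx fy :
  f x y <> 0 -> differentiable_pt_lim f x y fx fy ->
  differentiable_pt_lim (fun u v => / f u v) x y
    (- fx / (f x y) ^ 2) (- fy / (f x y) ^ 2).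
Proof.
intros Hn Hf.
eapply diff2_eq.
- apply (diff2_comp1 Rinv f x y fx fy (- / (f x y) ^ 2)); [|exact Hf].
  apply is_derive_Reals. auto_derive; [exact Hn|]. field; exact Hn.
- field; exact Hn.
- field; exact Hn.
Qed.

(** * Holomorphic functions of one complex variable *)

(** The derivative at (x, y) is p + i q; the two conjuncts are the Cauchy-
    Riemann equations for the real differential. *)
Definition holomorphic_at (F : C -> C) (x y : R) : Prop :=
  exists p q,
    differentiable_pt_lim (fun u v => Re (F (u, v))) x y p (- q) /\
    differentiable_pt_lim (fun u v => Im (F (u, v))) x y q p.

Lemma holo_ext_loc F G x y :
  locally_2d (fun u v => F (u, v) = G (u, v)) x y -> holomorphic_at F x y -> holomorphic_at G x y.
Proof.
intros E (p & q & H1 & H2); exists p, q; split.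
- apply differentiable_pt_lim_ext with (2 := H1).
  apply locally_2d_impl with (2 := E), locally_2d_forall; intros u v ->; reflexivity.
- apply differentiable_pt_lim_ext with (2 := H2).
  apply locally_2d_impl with (2 := E), locally_2d_forall; intros u v ->; reflexivity.
Qed.

Lemma holo_ext F G x y : (forall z, F z = G z) -> holomorphic_at F x y -> holomorphic_at G x y.
Proof. intros E; apply holo_ext_loc, locally_2d_forall; intros; apply E. Qed.

Lemma holo_const k x y : holomorphic_at (fun _ => k) x y.
Proof.
exists 0, 0; rewrite Ropp_0; split; apply diff2_const.
Qed.

Lemma holo_id x y : holomorphic_at (fun z => z) x y.
Proof.
exists 1, 0; split.
- apply diff2_ext with (fun u v => 1 * u + - 0 * v + 0); [apply diff2_affine|].
  intros; simpl; unfold Re, Im; ring.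
- apply diff2_ext with (fun u v => 0 * u + 1 * v + 0); [apply diff2_affine|].
  intros; simpl; unfold Re, Im; ring.
Qed.

Lemma holo_plus F G x y :
  holomorphic_at F x y -> holomorphic_at G x y -> holomorphic_at (fun z => F z + G z)%C x y.
Proof.
intros (p & q & H1 & H2) (p' & q' & H1' & H2'); exists (1 * p + 1 * p'), (1 * q + 1 * q'); split.
- eapply diff2_eq; [eapply diff2_ext; [exact (diff2_lincomb 1 1 _ _ _ _ _ _ _ _ H1 H1')|]| |];
  intros; simpl; unfold Re, Im; ring.
- eapply diff2_ext; [exact (diff2_lincomb 1 1 _ _ _ _ _ _ _ _ H2 H2')|]; intros; simpl; unfold Re, Im; ring.
Qed.

Lemma holo_mult F G x y :
  holomorphic_at F x y -> holomorphic_at G x y -> holomorphic_at (fun z => F z * G z)%C x y.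
Proof.
intros (p & q & H1 & H2) (p' & q' & H1' & H2').
set (a := Re (F (x, y))). set (b := Im (F (x, y))).
set (a' := Re (G (x, y))). set (b' := Im (G (x, y))).
exists (a * p' + p * a' - b * q' - q * b'), (a * q' + p * b' + b * p' + q * a'); split.
- eapply diff2_eq.
  + eapply diff2_ext.
    * exact (diff2_lincomb 1 (-1) _ _ _ _ _ _ _ _ (diff2_mult _ _ _ _ _ _ _ _ H1 H1')
               (diff2_mult _ _ _ _ _ _ _ _ H2 H2')).
    * intros; simpl; unfold Re, Im; ring.
  + cbv beta; fold a a' b b'; ring.
  + cbv beta; fold a a' b b'; ring.
- eapply diff2_eq.
  + eapply diff2_ext.
    * exact (diff2_lincomb 1 1 _ _ _ _ _ _ _ _ (diff2_mult _ _ _ _ _ _ _ _ H1 H2')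
               (diff2_mult _ _ _ _ _ _ _ _ H2 H1')).
    * intros; simpl; unfold Re, Im; ring.
  + cbv beta; fold a a' b b'; ring.
  + cbv beta; fold a a' b b'; ring.
Qed.

Lemma holo_scal k F x y : holomorphic_at F x y -> holomorphic_at (fun z => k * F z)%C x y.
Proof. apply holo_mult, holo_const. Qed.

Lemma holo_pow F n x y : holomorphic_at F x y -> holomorphic_at (fun z => F z ^ n)%C x y.
Proof.
intros H; induction n as [|n IH]; simpl; [apply holo_const|].
apply holo_mult; assumption.
Qed.

Lemma C_normsq_neq0 (z : C) : z <> 0%C -> Re z * Re z + Im z * Im z <> 0.
Proof.
intros Hz H; apply Hz; destruct z as [a b]; simpl in H.
apply injective_projections; simpl; nra.
Qed.

Lemma holo_inv (F : C -> C) x y : F (x, y) <> RtoC 0 -> holomorphic_at F x y -> holomorphic_at (fun z => / F z)%C x y.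
Proof.
intros Hn (p & q & H1 & H2).
assert (HN := C_normsq_neq0 _ Hn).
set (a := Re (F (x, y))) in *. set (b := Im (F (x, y))) in *.

assert (HN' : 1 * (a * a) + 1 * (b * b) <> 0) by (rewrite !Rmult_1_l; exact HN).
assert (HI := diff2_inv _ _ _ _ _ HN'
  (diff2_lincomb 1 1 _ _ _ _ _ _ _ _ (diff2_mult _ _ _ _ _ _ _ _ H1 H1)
     (diff2_mult _ _ _ _ _ _ _ _ H2 H2))).
cbv beta in HI; fold a b in HI.
set (N := a * a + b * b) in *.
exists ((p * (b * b - a * a) - 2 * a * b * q) / N ^ 2), ((2 * a * b * p + q * (b * b - a * a)) / N ^ 2).
split.
- eapply diff2_eq.
  + eapply diff2_ext; [exact (diff2_mult _ _ _ _ _ _ _ _ H1 HI)|].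
    intros u v; unfold Re, Im, Rdiv; simpl.
    rewrite !Rmult_1_l, !Rmult_1_r. reflexivity.
  + cbv beta; fold a b; unfold N; field; exact HN.
  + cbv beta; fold a b; unfold N; field; exact HN.
- eapply diff2_eq.
  + eapply diff2_ext; [exact (diff2_lincomb (-1) 0 _ _ _ _ _ _ _ _
      (diff2_mult _ _ _ _ _ _ _ _ H2 HI) H2)|].
    intros u v; unfold Re, Im; simpl.
    unfold Rdiv; rewrite !Rmult_1_l, !Rmult_1_r; ring.
  + cbv beta; fold a b; unfold N; field; exact HN.
  + cbv beta; fold a b; unfold N; field; exact HN.
Qed.

(** * The mean value property *)

Definition polar (x0 y0 s t : R) : C := (x0 + s * cos t, y0 + s * sin t).

Lemma polar_dist x0 y0 s t :
  (x0 + s * cos t - x0) ^ 2 + (y0 + s * sin t - y0) ^ 2 = s ^ 2.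
Proof. generalize (sin2_cos2 t); unfold Rsqr; nra. Qed.

Lemma diff2_polar (f : R -> R -> R) x0 y0 s t a b :
  differentiable_pt_lim f (x0 + s * cos t) (y0 + s * sin t) a b ->
  differentiable_pt_lim (fun s t => f (x0 + s * cos t) (y0 + s * sin t)) s t
    (a * cos t + b * sin t) (a * (- s * sin t) + b * (s * cos t)).
Proof.
intros H.
assert (Ht : differentiable_pt_lim (fun _ v => v) s t 0 1).
{ apply diff2_ext with (fun u v => 0 * u + 1 * v + 0); [apply diff2_affine | intros; ring]. }
assert (Hs : differentiable_pt_lim (fun u _ => u) s t 1 0).
{ apply diff2_ext with (fun u v => 1 * u + 0 * v + 0); [apply diff2_affine | intros; ring]. }
assert (Hc := diff2_comp1 cos _ _ _ _ _ _ (derivable_pt_lim_cos t) Ht).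
assert (Hn := diff2_comp1 sin _ _ _ _ _ _ (derivable_pt_lim_sin t) Ht).
assert (HX := diff2_lincomb 1 1 _ _ _ _ _ _ _ _ (diff2_const x0 s t) (diff2_mult _ _ _ _ _ _ _ _ Hs Hc)).
assert (HY := diff2_lincomb 1 1 _ _ _ _ _ _ _ _ (diff2_const y0 s t) (diff2_mult _ _ _ _ _ _ _ _ Hs Hn)).
cbv beta in HX, HY.
eapply diff2_eq.
- refine (differentiable_pt_lim_comp f (fun s t => x0 + s * cos t) (fun s t => y0 + s * sin t)
    s t a b _ _ _ _ H _ _).
  + eapply diff2_ext; [exact HX | intros; simpl; ring].
  + eapply diff2_ext; [exact HY | intros; simpl; ring].
- simpl; ring.
- simpl; ring.
Qed.

Lemma holo_polar_continuous (F : C -> C) x0 y0 s t :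
  holomorphic_at F (x0 + s * cos t) (y0 + s * sin t) ->
  continuity_2d_pt (fun s t => Re (F (polar x0 y0 s t))) s t /\
  continuity_2d_pt (fun s t => Im (F (polar x0 y0 s t))) s t.
Proof.
intros (p & q & H1 & H2); split; apply differentiable_continuity_pt.
- eexists; eexists; apply (diff2_polar (fun u v => Re (F (u, v)))), H1.
- eexists; eexists; apply (diff2_polar (fun u v => Im (F (u, v)))), H2.
Qed.

Lemma holo_continuous (F : C -> C) x y :
  holomorphic_at F x y ->
  continuity_2d_pt (fun u v => Re (F (u, v))) x y /\
  continuity_2d_pt (fun u v => Im (F (u, v))) x y.
Proof.
intros (p & q & H1 & H2); split; apply differentiable_continuity_pt.
- eexists; eexists; apply H1.
- eexists; eexists; apply H2.
Qed.

(** In polar coordinates, Im F / s ds + Re F dt is a closed form (the polar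
    Cauchy-Riemann equations). On the rectangle [s0, s1] x [0, 2 PI] its two
    sides t = 0 and t = 2 PI cancel by periodicity, and the other two are the
    two circle integrals. This gives the mean value property directly from
    Green's theorem, with no primitive and no Cauchy kernel. *)
Lemma circle_mean_constant (F : C -> C) x0 y0 s0 s1 :
  0 < s0 <= s1 ->
  (forall s t, s0 <= s <= s1 -> holomorphic_at F (x0 + s * cos t) (y0 + s * sin t)) ->
  RInt (fun t => Re (F (polar x0 y0 s1 t))) 0 (2 * PI) =
  RInt (fun t => Re (F (polar x0 y0 s0 t))) 0 (2 * PI).
Proof.
intros Hs HF. assert (Hpi := PI_RGT_0).
assert (G := green_closed_form (fun s t => Im (F (polar x0 y0 s t)) * / s)
  (fun s t => Re (F (polar x0 y0 s t))) s0 s1 0 (2 * PI)).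
unfold circulation, polar in G |- *.
rewrite sin_2PI, cos_2PI, sin_0, cos_0 in G.
cut (forall a b c, a + b - a - c = 0 -> b = c); [|intros; lra].
intros Hcut; eapply Hcut, G; [lra | lra |].
intros s t Hst _.
destruct (HF s t Hst) as (p & q & H1 & H2).
assert (K1 := diff2_polar (fun u v => Re (F (u, v))) x0 y0 s t _ _ H1).
assert (K2 := diff2_polar (fun u v => Im (F (u, v))) x0 y0 s t _ _ H2).
cbv beta in K1, K2.
assert (Hs' : differentiable_pt_lim (fun u _ => u) s t 1 0).
{ apply diff2_ext with (fun u v => 1 * u + 0 * v + 0); [apply diff2_affine | intros; ring]. }
assert (Hsn : s <> 0) by lra.
assert (K3 := diff2_mult _ _ _ _ _ _ _ _ K2 (diff2_inv _ _ _ _ _ Hsn Hs')).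
cbv beta in K3.
eexists; exists (p * cos t - q * sin t); eexists; split.
- eapply diff2_eq; [exact K3 | reflexivity | field; exact Hsn].
- eapply diff2_eq; [exact K1 | ring | reflexivity].
Qed.

(** The circle integrals do not depend on the radius; as it shrinks to zero
    they tend to the value at the centre, by continuity. *)
Lemma mean_value (F : C -> C) x0 y0 rho :
  0 < rho ->
  (forall x y, (x - x0) ^ 2 + (y - y0) ^ 2 <= rho ^ 2 -> holomorphic_at F x y) ->
  RInt (fun t => Re (F (polar x0 y0 rho t))) 0 (2 * PI) = 2 * PI * Re (F (x0, y0)).
Proof.
intros Hrho HF. assert (Hpi := PI_RGT_0).
assert (Hp : forall s t, 0 <= s <= rho -> holomorphic_at F (x0 + s * cos t) (y0 + s * sin t)).
{ intros s t Hs; apply HF; rewrite polar_dist; nra. }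
set (k := Re (F (x0, y0))).
set (J := RInt (fun t => Re (F (polar x0 y0 rho t))) 0 (2 * PI)).
assert (Hall : forall eps : posreal, Rabs (J - 2 * PI * k) <= 2 * PI * eps).
{ intros eps.
  destruct (holo_continuous F x0 y0) as [Hc _]; [apply HF; nra|].
  destruct (Hc eps) as [d Hd]. assert (Hd0 := cond_pos d).
  (* A circle small enough for F to be within eps of its value at the centre.
     *)
  set (s := Rmin (d / 2) rho).
  assert (Hs : 0 < s <= rho) by (split; [apply Rmin_pos; lra | apply Rmin_r]).
  assert (Hsd : s < d) by (apply Rle_lt_trans with (d / 2); [apply Rmin_l | lra]).
  unfold J; rewrite (circle_mean_constant F x0 y0 s rho); [|lra | intros; apply Hp; lra].
  replace (2 * PI * k) with ((2 * PI - 0) * k) by ring.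
  replace (2 * PI * eps) with ((2 * PI - 0) * eps) by ring.
  apply RInt_near_constant; [lra | |].
  - apply (ex_RInt_slice_y (fun s t => Re (F (polar x0 y0 s t)))).
    intros t _; apply holo_polar_continuous, Hp; lra.
  - intros t _; apply Rlt_le, Hd.
    + replace (x0 + s * cos t - x0) with (s * cos t) by ring.
      rewrite Rabs_mult, (Rabs_pos_eq s) by lra.
      assert (Rabs (cos t) <= 1) by (apply Rabs_le, COS_bound). nra.
    + replace (y0 + s * sin t - y0) with (s * sin t) by ring.
      rewrite Rabs_mult, (Rabs_pos_eq s) by lra.
      assert (Rabs (sin t) <= 1) by (apply Rabs_le, SIN_bound). nra. }
apply Rminus_diag_uniq, NNPP; intros Hne.
assert (Hpos := Rabs_pos_lt _ Hne).
set (h := Rabs (J - 2 * PI * k)) in *.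
assert (He : 0 < h / (4 * PI)) by (apply Rdiv_lt_0_compat; lra).
specialize (Hall (mkposreal _ He)); simpl in Hall.
replace (2 * PI * (h / (4 * PI))) with (h / 2) in Hall by (field; lra). lra.
Qed.

(** * The identity theorem on a disc *)

Lemma C_dist_sq (a b c d : R) : Cmod ((a, b) - (c, d))%C ^ 2 = (a - c) ^ 2 + (b - d) ^ 2.
Proof. rewrite Cmod2_alt; simpl; ring. Qed.

(** If F vanishes near z0, then F(w) ((z1 - z0) / (w - z0))^n is still
    holomorphic at z0, and takes the value F(z1) at z1 for every n. On the
    circle of radius rho about z1 the second factor tends to 0 as n grows,
    because z1 is closer to z0 than the circle is; the mean value property at
    z1 then forces F(z1) = 0. *)
Lemma holo_zero_step_re (F : C -> C) x0 y0 x1 y1 rho :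
  0 < rho ->
  (forall x y, (x - x1) ^ 2 + (y - y1) ^ 2 <= rho ^ 2 -> holomorphic_at F x y) ->
  locally_2d (fun u v => F (u, v) = 0%C) x0 y0 ->
  4 * ((x0 - x1) ^ 2 + (y0 - y1) ^ 2) < rho ^ 2 ->
  Re (F (x1, y1)) = 0.
Proof.
intros Hrho HF Hz Hd. assert (Hpi := PI_RGT_0).
set (z0 := (x0, y0) : C). set (z1 := (x1, y1) : C).
destruct (classic (z1 = z0)) as [E | Hne].
{ assert (H := locally_2d_singleton _ _ _ Hz). rewrite E; unfold z0; rewrite H; reflexivity. }
set (d := Cmod (z1 - z0)).
assert (Hzz : (z1 - z0)%C <> 0%C).
{ intros H; apply Hne. replace z1 with (z1 - z0 + z0)%C by ring. rewrite H; ring. }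
assert (Hd0 : 0 < d) by (apply Cmod_gt_0, Hzz).
assert (Hd2 : 2 * d < rho).
{ assert (E : d ^ 2 = (x0 - x1) ^ 2 + (y0 - y1) ^ 2)
    by (unfold d, z0, z1; rewrite C_dist_sq; ring).
  rewrite <- E in Hd; nra. }
(* At w = z0 the inverse is that of 0, which is harmless as F z0 = 0. *)
set (G := fun n w => (F w * ((z1 - z0) * / (w - z0)) ^ n)%C).
assert (HG : forall n x y, (x - x1) ^ 2 + (y - y1) ^ 2 <= rho ^ 2 -> holomorphic_at (G n) x y).
{ intros n x y Hxy. destruct (classic (((x, y) : C) = z0)) as [E | Hn].
  - unfold z0 in E; injection E as -> ->.
    apply holo_ext_loc with (fun _ => 0%C); [|apply holo_const].
    apply locally_2d_impl with (2 := Hz), locally_2d_forall.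
    intros u v E; unfold G; rewrite E; ring.
  - apply holo_mult; [apply HF, Hxy|].
    apply holo_pow, holo_scal, holo_inv.
    + intros E; apply Hn. replace ((x, y) : C) with ((x, y) - z0 + z0)%C by ring.
      rewrite E; ring.
    + apply holo_plus; [apply holo_id | apply holo_const]. }
assert (HGz : forall n, G n z1 = F z1).
{ intros n; unfold G. rewrite Cinv_r by exact Hzz.
  replace (1 ^ n)%C with (RtoC 1); [ring|].
  induction n as [|n IH]; simpl; [reflexivity | rewrite <- IH; ring]. }
assert (Hpc : forall t, continuous (fun t => Re (F (polar x1 y1 rho t))) t /\
   continuous (fun t => Im (F (polar x1 y1 rho t))) t).
{ intros t.
  destruct (holo_polar_continuous F x1 y1 rho t) as [K1 K2].
  { apply HF; rewrite polar_dist; lra. }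
  split; [apply (continuity_2d_pt_slice_y (fun s t => Re (F (polar x1 y1 s t)))), K1
   | apply (continuity_2d_pt_slice_y (fun s t => Im (F (polar x1 y1 s t)))), K2]. }
destruct (bounded_continuity (V := R_NormedModule) (fun t => Re (F (polar x1 y1 rho t))) 0 (2 * PI))
  as [M1 HM1]; [intros; apply Hpc|].
destruct (bounded_continuity (V := R_NormedModule) (fun t => Im (F (polar x1 y1 rho t))) 0 (2 * PI))
  as [M2 HM2]; [intros; apply Hpc|].
set (q := d / (rho - d)).
assert (Hq : 0 <= q < 1).
{ unfold q; split; [apply Rlt_le, Rdiv_lt_0_compat; lra|].
  apply Rmult_lt_reg_r with (rho - d); [lra|].
  unfold Rdiv; rewrite Rmult_assoc, Rinv_l by lra; lra. }
assert (Hbound : forall n, Rabs (Re (F z1)) <= (M1 + M2) * q ^ n).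
{ intros n.
  assert (HMV := mean_value (G n) x1 y1 rho Hrho (HG n)).
  change (x1, y1) with z1 in HMV; rewrite HGz in HMV.
  assert (HB : Rabs (RInt (fun t => Re (G n (polar x1 y1 rho t))) 0 (2 * PI))
     <= (2 * PI - 0) * ((M1 + M2) * q ^ n)).
  { apply abs_RInt_le_const; [lra | |].
    - apply (ex_RInt_slice_y (fun s t => Re (G n (polar x1 y1 s t)))).
      intros t _; apply holo_polar_continuous, HG; rewrite polar_dist; lra.
    - intros t Ht; apply Rle_trans with (1 := re_le_Cmod _).
      unfold G; rewrite Cmod_mult, Cmod_pow, Cmod_mult; fold d.
      set (w := polar x1 y1 rho t).
      assert (Hw : Cmod (w - z1) = rho).
      { assert (E : Cmod (w - z1) ^ 2 = rho ^ 2)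
          by (unfold w, z1, polar; rewrite C_dist_sq; apply polar_dist).
        generalize (Cmod_ge_0 (w - z1)); nra. }
      assert (Hwz : rho - d <= Cmod (w - z0)).
      { assert (T := Cmod_triangle (w - z0) (z0 - z1)).
        replace (w - z0 + (z0 - z1))%C with (w - z1)%C in T by ring.
        replace (Cmod (z0 - z1)) with d in T; [lra|].
        unfold d; rewrite <- Cmod_opp; f_equal; ring. }
      assert (Hwn : (w - z0)%C <> 0%C) by (apply Cmod_gt_0; lra).
      rewrite Cmod_inv by exact Hwn.
      apply Rmult_le_compat; [apply Cmod_ge_0 | | |].
      + apply pow_le, Rmult_le_pos; [lra|]. apply Rlt_le, Rinv_0_lt_compat; lra.
      + apply Rle_trans with (Rabs (Re (F w)) + Rabs (Im (F w))).
        * assert (E : Cmod (F w) ^ 2 = Re (F w) ^ 2 + Im (F w) ^ 2) by apply Cmod2_alt.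
          rewrite <- (pow2_abs (Re _)), <- (pow2_abs (Im _)) in E.
          generalize (Cmod_ge_0 (F w)) (Rabs_pos (Re (F w))) (Rabs_pos (Im (F w))); nra.
        * apply Rlt_le, Rplus_lt_compat; [apply HM1 | apply HM2]; lra.
      + apply pow_incr; split.
        * apply Rmult_le_pos; [lra|]. apply Rlt_le, Rinv_0_lt_compat; lra.
        * unfold q; apply Rmult_le_compat_l; [lra|]. apply Rinv_le_contravar; lra. }
  rewrite HMV, Rabs_mult, (Rabs_pos_eq (2 * PI)) in HB by lra.
  apply Rmult_le_reg_l with (2 * PI); lra. }
apply NNPP; intros Hn0.
assert (Hpos := Rabs_pos_lt _ Hn0); fold z1 in Hpos.
set (M := M1 + M2) in *.
assert (HM : 0 < M + 1).
{ specialize (Hbound O); simpl in Hbound; lra. }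
destruct (pow_lt_1_zero q) with (y := Rabs (Re (F z1)) / (M + 1)) as [N HN].
{ rewrite Rabs_pos_eq; lra. }
{ apply Rdiv_lt_0_compat; lra. }
specialize (HN N (Nat.le_refl _)). specialize (Hbound N).
rewrite Rabs_pos_eq in HN by (apply pow_le; lra).
assert (Hqn : 0 <= q ^ N) by (apply pow_le; lra).
assert ((M + 1) * q ^ N < Rabs (Re (F z1))).
{ apply Rmult_lt_compat_l with (r := M + 1) in HN; [|lra].
  replace ((M + 1) * (Rabs (Re (F z1)) / (M + 1))) with (Rabs (Re (F z1))) in HN
    by (field; lra). exact HN. }
nra.
Qed.

(** The imaginary part is the real part of - i F. *)
Lemma holo_zero_step (F : C -> C) x0 y0 x1 y1 rho :
  0 < rho ->
  (forall x y, (x - x1) ^ 2 + (y - y1) ^ 2 <= rho ^ 2 -> holomorphic_at F x y) ->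
  locally_2d (fun u v => F (u, v) = RtoC 0) x0 y0 ->
  4 * ((x0 - x1) ^ 2 + (y0 - y1) ^ 2) < rho ^ 2 ->
  F (x1, y1) = RtoC 0.
Proof.
intros Hrho HF Hz Hd.
apply injective_projections.
- exact (holo_zero_step_re F x0 y0 x1 y1 rho Hrho HF Hz Hd).
- replace (snd (F (x1, y1))) with (Re (- Ci * F (x1, y1))%C) by (simpl; unfold Re, Im; ring).
  apply (holo_zero_step_re (fun z => - Ci * F z)%C x0 y0 x1 y1 rho Hrho); [| |exact Hd].
  + intros x y Hxy; apply holo_scal, HF, Hxy.
  + apply locally_2d_impl with (2 := Hz), locally_2d_forall; intros u v ->; ring.
Qed.

Lemma Cmod_coord_le (u v x y : R) :
  Cmod ((u, v) - (x, y))%C <= Rabs (u - x) + Rabs (v - y).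
Proof.
assert (E := C_dist_sq u v x y).
rewrite <- (pow2_abs (u - x)), <- (pow2_abs (v - y)) in E.
generalize (Cmod_ge_0 ((u, v) - (x, y))) (Rabs_pos (u - x)) (Rabs_pos (v - y)); nra.
Qed.

Lemma Cmod_sub_triangle (z w : C) : Cmod z <= Cmod w + Cmod (z - w).
Proof.
assert (T := Cmod_triangle w (z - w)).
replace (w + (z - w))%C with z in T by ring. exact T.
Qed.

Lemma locally_2d_disc r x y :
  Cmod (x, y) < r -> locally_2d (fun u v => Cmod (u, v) < r) x y.
Proof.
intros H. assert (Hd : 0 < (r - Cmod (x, y)) / 2) by lra.
exists (mkposreal _ Hd); simpl; intros u v Hu Hv.
assert (T := Cmod_sub_triangle (u, v) (x, y)).
assert (K := Cmod_coord_le u v x y). lra.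
Qed.

(** The vanishing near z0 is propagated along the segment from z0 to z1, which
    keeps a fixed distance from the boundary of the disc, by steps of length
    small against that distance. *)
Theorem holo_identity (F : C -> C) r x0 y0 x1 y1 :
  (forall x y, Cmod (x, y) < r -> holomorphic_at F x y) ->
  Cmod (x0, y0) < r -> Cmod (x1, y1) < r ->
  locally_2d (fun u v => F (u, v) = RtoC 0) x0 y0 ->
  F (x1, y1) = RtoC 0.
Proof.
intros HF H0 H1 Hz.
set (m := Rmax (Cmod (x0, y0)) (Cmod (x1, y1))).
assert (Hm : m < r) by (apply Rmax_lub_lt; assumption).
assert (Hm0 := Rmax_l (Cmod (x0, y0)) (Cmod (x1, y1)) : Cmod (x0, y0) <= m).
assert (Hm1 := Rmax_r (Cmod (x0, y0)) (Cmod (x1, y1)) : Cmod (x1, y1) <= m).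
(* Discs of radius rho about points near the segment stay inside the disc of
   radius r. *)
set (rho := (r - m) / 4). assert (Hrho : 0 < rho) by (unfold rho; lra).
set (D := Rabs (x1 - x0) + Rabs (y1 - y0)).
assert (HD : 0 <= D) by (apply Rplus_le_le_0_compat; apply Rabs_pos).
destruct (INR_unbounded (4 * D / rho)) as [N HN].
assert (HN0 : 0 < INR N).
{ apply Rle_lt_trans with (2 := HN). apply Rmult_le_pos; [lra|].
  apply Rlt_le, Rinv_0_lt_compat, Hrho. }
assert (Hstep : D / INR N < rho / 4).
{ apply Rmult_lt_reg_r with (INR N); [exact HN0|].
  unfold Rdiv at 1; rewrite Rmult_assoc, Rinv_l by lra.
  apply Rmult_lt_compat_r with (r := rho / 4) in HN; [|lra].
  replace (4 * D / rho * (rho / 4)) with D in HN by (field; lra). lra. }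
set (px := fun k : nat => x0 + INR k / INR N * (x1 - x0)).
set (py := fun k : nat => y0 + INR k / INR N * (y1 - y0)).
assert (Hk : forall k, (k <= N)%nat ->
  locally_2d (fun u v => F (u, v) = RtoC 0) (px k) (py k)).
{ induction k as [|k IH]; intros HkN.
  - unfold px, py; simpl. unfold Rdiv; rewrite !Rmult_0_l, !Rplus_0_r; exact Hz.
  - assert (Hd : 0 < rho / 8) by lra.
    exists (mkposreal _ Hd); simpl; intros u v Hu Hv.
    apply (holo_zero_step F (px k) (py k) u v rho Hrho); [| apply IH; lia |].
    + intros x y Hxy; apply HF.
      assert (T1 := Cmod_sub_triangle (x, y) (u, v)).
      assert (T2 := Cmod_sub_triangle (u, v) (px (S k), py (S k))).
      assert (K := Cmod_coord_le u v (px (S k)) (py (S k))).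
      rewrite <- C_dist_sq in Hxy.
      assert (Cmod ((x, y) - (u, v)) <= rho)
        by (generalize (Cmod_ge_0 ((x, y) - (u, v))); nra).
      assert (Hconv : Cmod (px (S k), py (S k)) <= m).
      { set (t := INR (S k) / INR N).
        assert (Ht : 0 <= t <= 1).
        { unfold t; split.
          - apply Rmult_le_pos; [apply pos_INR | apply Rlt_le, Rinv_0_lt_compat, HN0].
          - apply Rmult_le_reg_r with (INR N); [exact HN0|].
            unfold Rdiv; rewrite Rmult_assoc, Rinv_l, Rmult_1_l, Rmult_1_r by lra.
            apply le_INR, HkN. }
        replace ((px (S k), py (S k)) : C) with
          (RtoC (1 - t) * (x0, y0) + RtoC t * (x1, y1))%C
          by (apply injective_projections; unfold px, py; fold t; simpl; ring).
        apply Rle_trans with (1 := Cmod_triangle _ _).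
        rewrite !Cmod_mult, !Cmod_R, !Rabs_pos_eq by lra. nra. }
      unfold rho in *; lra.
    + assert (E : px (S k) - px k = (x1 - x0) / INR N)
        by (unfold px; rewrite S_INR; field; lra).
      assert (E' : py (S k) - py k = (y1 - y0) / INR N)
        by (unfold py; rewrite S_INR; field; lra).
      assert (K : Cmod ((px k, py k) - (u, v)) < rho / 2).
      { apply Rle_lt_trans with (1 := Cmod_coord_le _ _ _ _).
        assert (A1 : Rabs (px k - u) <= Rabs (u - px (S k)) + Rabs (px (S k) - px k)).
        { replace (px k - u) with (- ((u - px (S k)) + (px (S k) - px k))) by ring.
          rewrite Rabs_Ropp; apply Rabs_triang. }
        assert (A2 : Rabs (py k - v) <= Rabs (v - py (S k)) + Rabs (py (S k) - py k)).
        { replace (py k - v) with (- ((v - py (S k)) + (py (S k) - py k))) by ring.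
          rewrite Rabs_Ropp; apply Rabs_triang. }
        rewrite E in A1; rewrite E' in A2.
        unfold Rdiv in A1, A2; rewrite Rabs_mult in A1, A2.
        rewrite (Rabs_pos_eq (/ INR N)) in A1, A2
          by (apply Rlt_le, Rinv_0_lt_compat, HN0).
        assert (E3 : Rabs (x1 - x0) * / INR N + Rabs (y1 - y0) * / INR N = D / INR N)
          by (unfold D; field; lra).
        lra. }
      rewrite <- C_dist_sq.
      generalize (Cmod_ge_0 ((px k, py k) - (u, v))); nra. }
specialize (Hk N (Nat.le_refl _)).
apply locally_2d_singleton in Hk.
unfold px, py in Hk.
replace (x0 + INR N / INR N * (x1 - x0)) with x1 in Hk by (field; lra).
replace (y0 + INR N / INR N * (y1 - y0)) with y1 in Hk by (field; lra).
exact Hk.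
Qed.

(** * Functions vanishing on the real diameter *)

Lemma diff2_zero_on_axis f x p q :
  differentiable_pt_lim f x 0 p q ->
  locally x (fun u => f u 0 = 0) -> p = 0.
Proof.
intros H E.
destruct (differentiable_pt_lim_unique f x 0 p q H) as [<- _].
rewrite (Derive_ext_loc _ (fun _ => 0)); [apply Derive_const | exact E].
Qed.

(** Where the differential of f vanishes, f may be replaced by 0 on any set of
    points without destroying differentiability. *)
Lemma diff2_cut f g x :
  differentiable_pt_lim f x 0 0 0 -> f x 0 = 0 -> g x 0 = 0 ->
  (forall u v, g u v = f u v \/ g u v = 0) ->
  differentiable_pt_lim g x 0 0 0.
Proof.
intros H Hf Hg Hfg eps; destruct (H eps) as [d Hd]; exists d; intros u v Hu Hv.
specialize (Hd u v Hu Hv). rewrite Hg; rewrite Hf in Hd.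
destruct (Hfg u v) as [-> | ->]; [exact Hd|].
replace (0 - 0 - (0 * (u - x) + 0 * (v - 0))) with 0 by ring.
rewrite Rabs_R0; apply Rle_trans with (2 := Hd), Rabs_pos.
Qed.

(** At a real point F has derivative zero, because it vanishes along the real
    axis. Hence F cut off to zero on the opposite half disc is still
    differentiable, so holomorphic, and the identity theorem applies to it.
    The sign s selects the half disc. *)
Lemma holo_zero_half_disc (F : C -> C) r s :
  0 < r -> s * s = 1 ->
  (forall x y, Cmod (x, y) < r -> holomorphic_at F x y) ->
  (forall x, Cmod (x, 0) < r -> F (x, 0) = RtoC 0) ->
  forall x y, Cmod (x, y) < r -> 0 < s * y -> F (x, y) = RtoC 0.
Proof.
intros Hr Hs HF H0 x1 y1 Hxy1 Hy1.
set (G := fun z : C => if Rlt_dec 0 (s * Im z) then F z else RtoC 0).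
assert (Hpos : forall x y, 0 < s * y -> locally_2d (fun _ v => 0 < s * v) x y).
{ intros x y Hy.
  assert (Hc : continuity_2d_pt (fun _ v => s * v) x y).
  { apply continuity_2d_pt_mult; [apply continuity_2d_pt_const | apply continuity_2d_pt_id2]. }
  destruct (Hc (mkposreal _ Hy)) as [d Hd]; exists d; intros u v Hu Hv.
  specialize (Hd u v Hu Hv); simpl in Hd; apply Rabs_def2 in Hd; lra. }
assert (Hneg : forall x y, s * y < 0 -> locally_2d (fun u v => G (u, v) = RtoC 0) x y).
{ intros x y Hy.
  assert (Hc : continuity_2d_pt (fun _ v => s * v) x y).
  { apply continuity_2d_pt_mult; [apply continuity_2d_pt_const | apply continuity_2d_pt_id2]. }
  assert (Hy' : 0 < - (s * y)) by lra.
  destruct (Hc (mkposreal _ Hy')) as [d Hd]; exists d; intros u v Hu Hv.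
  specialize (Hd u v Hu Hv); simpl in Hd; apply Rabs_def2 in Hd.
  unfold G; simpl; destruct Rlt_dec; [lra | reflexivity]. }
assert (HG : forall x y, Cmod (x, y) < r -> holomorphic_at G x y).
{ intros x y Hxy.
  destruct (Rtotal_order 0 (s * y)) as [Hy | [Hy | Hy]].
  - apply holo_ext_loc with F; [|apply HF, Hxy].
    apply locally_2d_impl with (2 := Hpos x y Hy), locally_2d_forall.
    intros u v Hv; unfold G; simpl; destruct Rlt_dec; [reflexivity | lra].
  - assert (y = 0) by nra. subst y.
    destruct (HF x 0 Hxy) as (p & q & H1 & H2).
    assert (Hax : locally x (fun u => F (u, 0) = RtoC 0)).
    { apply filter_imp with (fun u => Cmod (u, 0) < r); [apply H0|].
      apply (locally_2d_1d_const_y (fun u v => Cmod (u, v) < r)).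
      apply locally_2d_disc, Hxy. }
    assert (Hp : p = 0).
    { apply (diff2_zero_on_axis _ _ _ _ H1).
      apply filter_imp with (2 := Hax); exact (fun u E => f_equal Re E). }
    assert (Hq : q = 0).
    { apply (diff2_zero_on_axis _ _ _ _ H2).
      apply filter_imp with (2 := Hax); exact (fun u E => f_equal Im E). }
    subst p q; rewrite Ropp_0 in H1.
    exists 0, 0; rewrite Ropp_0; split.
    + apply diff2_cut with (1 := H1); [rewrite H0 by exact Hxy; reflexivity | |];
        unfold G; simpl; intros; destruct Rlt_dec; try lra; auto.
    + apply diff2_cut with (1 := H2); [rewrite H0 by exact Hxy; reflexivity | |];
        unfold G; simpl; intros; destruct Rlt_dec; try lra; auto.
  - apply holo_ext_loc with (fun _ => RtoC 0); [|apply holo_const].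
    apply locally_2d_impl with (2 := Hneg x y ltac:(lra)), locally_2d_forall.
    intros u v ->; reflexivity. }
assert (E : G (x1, y1) = RtoC 0).
{ apply (holo_identity G r 0 (- s * (r / 2))); [exact HG | | exact Hxy1 | apply Hneg; nra].
  assert (E : Cmod (0, - s * (r / 2)) ^ 2 = (r / 2) ^ 2)
    by (rewrite Cmod2_alt; simpl; nra).
  generalize (Cmod_ge_0 (0, - s * (r / 2))); nra. }
unfold G in E; simpl in E; destruct Rlt_dec; [exact E | lra].
Qed.

Theorem holo_zero_of_axis (F : C -> C) r :
  (forall x y, Cmod (x, y) < r -> holomorphic_at F x y) ->
  (forall x, Cmod (x, 0) < r -> F (x, 0) = RtoC 0) ->
  forall x y, Cmod (x, y) < r -> F (x, y) = RtoC 0.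
Proof.
intros HF H0 x y Hxy.
assert (Hr : 0 < r) by (apply Rle_lt_trans with (2 := Hxy), Cmod_ge_0).
destruct (Rtotal_order 0 y) as [Hy | [Hy | Hy]].
- apply (holo_zero_half_disc F r 1); try assumption; lra.
- subst y; apply H0, Hxy.
- apply (holo_zero_half_disc F r (-1)); try assumption; lra.
Qed.

(** * The maximum principle for the real part *)

(** Used for the equality case of the mean value inequality. *)
Lemma RInt_zero_nonneg (f : R -> R) a b :
  a < b -> (forall t, continuous f t) -> (forall t, 0 <= f t) -> RInt f a b = 0 ->
  forall t, a <= t <= b -> f t = 0.
Proof.
intros Hab Hc Hf HI t Ht.
destruct (Hf t) as [Hpos | E]; [exfalso | symmetry; exact E].
assert (Hloc : locally t (fun u => 0 < f u)).
{ apply (Hc t (fun v => 0 < v)). apply (open_gt 0), Hpos. }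
destruct Hloc as [d Hd]. assert (Hd0 := cond_pos d).
set (p := Rmax a (t - d / 2)). set (q := Rmin b (t + d / 2)).
assert (Hp : a <= p /\ t - d / 2 <= p) by (split; [apply Rmax_l | apply Rmax_r]).
assert (Hq : q <= b /\ q <= t + d / 2) by (split; [apply Rmin_l | apply Rmin_r]).
assert (Hp' : p <= t /\ p < b) by (unfold p; split; [apply Rmax_lub | apply Rmax_lub_lt]; lra).
assert (Hq' : t <= q /\ a < q) by (unfold q; split; [apply Rmin_glb | apply Rmin_glb_lt]; lra).
assert (Hpq : p < q).
{ unfold p; apply Rmax_lub_lt; [lra|]. unfold q; apply Rmin_glb_lt; lra. }
assert (ex : forall u v, ex_RInt f u v).
{ intros u v; apply (ex_RInt_continuous (V := R_CompleteNormedModule)); intros; apply Hc. }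
assert (C1 := RInt_Chasles (V := R_CompleteNormedModule) f a p b (ex _ _) (ex _ _)).
assert (C2 := RInt_Chasles (V := R_CompleteNormedModule) f p q b (ex _ _) (ex _ _)).
assert (I1 : 0 <= RInt f a p) by (apply RInt_ge_0; auto; lra).
assert (I3 : 0 <= RInt f q b) by (apply RInt_ge_0; auto; lra).
assert (I2 : 0 < RInt f p q).
{ apply RInt_gt_0; [exact Hpq | | intros; apply Hc].
  intros u Hu; apply Hd. apply Rabs_def1; unfold minus, plus, opp; simpl; lra. }
unfold plus in C1, C2; simpl in C1, C2; lra.
Qed.

Lemma unit_circle_param (u v : R) :
  u ^ 2 + v ^ 2 = 1 -> exists t, 0 <= t <= 2 * PI /\ u = cos t /\ v = sin t.
Proof.
intros H. assert (Hpi := PI_RGT_0).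
assert (Hu : -1 <= u <= 1) by nra.
assert (Hb := acos_bound u).
assert (Hs : sin (acos u) = sqrt (v ^ 2)).
{ rewrite sin_acos by exact Hu. f_equal; unfold Rsqr; lra. }
destruct (Rle_or_lt 0 v) as [Hv | Hv].
- exists (acos u); split; [lra|]. rewrite cos_acos by exact Hu.
  rewrite Hs, sqrt_pow2 by exact Hv; auto.
- exists (2 * PI - acos u); split; [lra|].
  rewrite cos_minus, sin_minus, cos_2PI, sin_2PI, cos_acos, Hs by exact Hu.
  replace (v ^ 2) with ((- v) ^ 2) by ring. rewrite sqrt_pow2 by lra. lra.
Qed.

Lemma Rabs_lt_of_sq a b : 0 < b -> a ^ 2 < b ^ 2 -> Rabs a < b.
Proof.
intros Hb H. rewrite <- (pow2_abs a) in H.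
destruct (Rlt_le_dec (Rabs a) b); [assumption | nra].
Qed.

(** On each small circle about the maximum point, the nonnegative function Re
    F(z0) - Re F has integral zero by the mean value property. *)
Lemma holo_re_max (F : C -> C) x0 y0 :
  locally_2d (fun u v => holomorphic_at F u v /\ Re (F (u, v)) <= Re (F (x0, y0))) x0 y0 ->
  locally_2d (fun u v => Re (F (u, v)) = Re (F (x0, y0))) x0 y0.
Proof.
intros [d Hd]. assert (Hd0 := cond_pos d). assert (Hpi := PI_RGT_0).
assert (Hd2 : 0 < d / 2) by lra.
assert (Hin : forall x y, (x - x0) ^ 2 + (y - y0) ^ 2 < d ^ 2 ->
  holomorphic_at F x y /\ Re (F (x, y)) <= Re (F (x0, y0))).
{ intros x y Hxy; apply Hd; apply Rabs_lt_of_sq; try lra;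
  generalize (pow2_ge_0 (x - x0)) (pow2_ge_0 (y - y0)); lra. }
exists (mkposreal _ Hd2); simpl; intros u v Hu Hv.
set (s := sqrt ((u - x0) ^ 2 + (v - y0) ^ 2)).
assert (Hs2 : s ^ 2 = (u - x0) ^ 2 + (v - y0) ^ 2).
{ unfold s; rewrite pow2_sqrt; [reflexivity | apply Rplus_le_le_0_compat; apply pow2_ge_0]. }
assert (Hs0 : 0 <= s) by apply sqrt_pos.
assert (Hsd : s ^ 2 < d ^ 2).
{ rewrite Hs2. apply Rabs_def2 in Hu, Hv. nra. }
destruct Hs0 as [Hs0 | E].
2:{ rewrite <- E in Hs2.
    generalize (pow2_ge_0 (u - x0)) (pow2_ge_0 (v - y0)); intros Hu2 Hv2.
    assert (u - x0 = 0) by (apply Rsqr_0_uniq; unfold Rsqr; lra).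
    assert (v - y0 = 0) by (apply Rsqr_0_uniq; unfold Rsqr; lra).
    replace u with x0 by lra; replace v with y0 by lra; reflexivity. }
destruct (unit_circle_param ((u - x0) / s) ((v - y0) / s)) as [t (Ht & Ec & Es)].
{ replace (((u - x0) / s) ^ 2 + ((v - y0) / s) ^ 2)
    with (((u - x0) ^ 2 + (v - y0) ^ 2) / s ^ 2) by (field; lra).
  rewrite <- Hs2; field; lra. }
assert (Epol : ((u, v) : C) = polar x0 y0 s t).
{ unfold polar; rewrite <- Ec, <- Es; f_equal; field; lra. }
assert (Hpol : forall t, holomorphic_at F (x0 + s * cos t) (y0 + s * sin t) /\
  Re (F (polar x0 y0 s t)) <= Re (F (x0, y0))).
{ intros t'; apply Hin; rewrite polar_dist; exact Hsd. }
set (k := Re (F (x0, y0))) in *.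
assert (Hcont : forall t, continuous (fun t => Re (F (polar x0 y0 s t))) t).
{ intros t'. apply (continuity_2d_pt_slice_y (fun s t => Re (F (polar x0 y0 s t)))).
  apply holo_polar_continuous, Hpol. }
assert (MV : RInt (fun t => Re (F (polar x0 y0 s t))) 0 (2 * PI) = 2 * PI * k).
{ apply mean_value; [exact Hs0|]. intros x y Hxy; apply Hin; lra. }
assert (Z : k - Re (F (polar x0 y0 s t)) = 0).
{ apply (RInt_zero_nonneg (fun t => k - Re (F (polar x0 y0 s t))) 0 (2 * PI)); [lra | | | | exact Ht].
  - intros t'; apply (continuous_minus (V := R_NormedModule));
      [apply continuous_const | apply Hcont].
  - intros t'; specialize (Hpol t'); lra.
  - rewrite (RInt_minus (V := R_CompleteNormedModule)).
    + rewrite RInt_const, MV; unfold minus, plus, opp, scal; simpl; unfold mult; simpl; ring.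
    + apply ex_RInt_const.
    + apply (ex_RInt_continuous (V := R_CompleteNormedModule)); intros; apply Hcont. }
rewrite Epol; lra.
Qed.

(** * Quaternion algebra *)

Local Infix "**" := qmult (at level 40, left associativity).

(** The Euclidean inner product, so that qdot q q is the square of qnorm q. *)
Definition qdot (p q : quat) : R :=
  let '(a1, b1, c1, d1) := p in
  let '(a2, b2, c2, d2) := q in a1 * a2 + b1 * b2 + c1 * c2 + d1 * d2.

Definition qconj (q : quat) : quat := let '(a, b, c, d) := q in (a, - b, - c, - d).

Definition qinv (q : quat) : quat := scal (/ qdot q q) (qconj q).

Lemma qplusE (a b c d a' b' c' d' : R) :
  plus ((a, b, c, d) : quat) ((a', b', c', d') : quat) = (a + a', b + b', c + c', d + d').
Proof. reflexivity. Qed.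

Lemma qscalE (k a b c d : R) :
  scal k ((a, b, c, d) : quat) = (k * a, k * b, k * c, k * d).
Proof. reflexivity. Qed.

Lemma qoppE (a b c d : R) : opp ((a, b, c, d) : quat) = (- a, - b, - c, - d).
Proof. reflexivity. Qed.

Lemma qzeroE : (zero : quat) = (0, 0, 0, 0).
Proof. reflexivity. Qed.

Ltac qcoord :=
  repeat match goal with q : quat |- _ => destruct q as [[[? ?] ?] ?] end;
  repeat progress (unfold slice_pt, RtoQ, qinv, qconj, qmult, qdot in *;
    rewrite ?qzeroE, ?qoppE, ?qscalE, ?qplusE in *; cbv beta iota zeta in *).

Ltac qring := intros; qcoord; repeat apply (f_equal2 pair);
  try match goal with |- @eq _ ?a ?b => change (@eq R a b) end; try ring.

Lemma qmult_assoc (p q s : quat) : p ** q ** s = p ** (q ** s).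
Proof. qring. Qed.

Lemma qmult_plus_r (p q s : quat) : p ** plus q s = plus (p ** q) (p ** s).
Proof. qring. Qed.

Lemma qmult_plus_l (p q s : quat) : plus p q ** s = plus (p ** s) (q ** s).
Proof. qring. Qed.

Lemma qdot_plus_r (e p q : quat) : qdot e (plus p q) = qdot e p + qdot e q.
Proof. qring. Qed.

Lemma qdot_scal_r (e : quat) (k : R) (p : quat) : qdot e (scal k p) = k * qdot e p.
Proof. qring. Qed.

Lemma qdot_mult (p q : quat) : qdot (p ** q) (p ** q) = qdot p p * qdot q q.
Proof. qring. Qed.

Lemma qdot_conj_r (e q : quat) : qdot e (qconj q) = qdot (qconj e) q.
Proof. qring. Qed.

Lemma qdot_ge_0 (q : quat) : 0 <= qdot q q.
Proof. qcoord; nra. Qed.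

Lemma qdot_eq_0 (q : quat) : qdot q q = 0 -> q = zero.
Proof.
intros H; qcoord. repeat apply (f_equal2 pair); nra.
Qed.

Lemma qdot_neq_0 (q : quat) : q <> zero -> qdot q q <> 0.
Proof. intros H E; apply H, qdot_eq_0, E. Qed.

Lemma qnorm_sqrt (q : quat) : qnorm q = sqrt (qdot q q).
Proof. qcoord; unfold qnorm; f_equal; ring. Qed.

Lemma qmult_qinv_r (q : quat) : q <> zero -> q ** qinv q = RtoQ 1.
Proof.
intros H. apply qdot_neq_0 in H. qcoord. repeat apply (f_equal2 pair); field; exact H.
Qed.

Lemma qmult_qinv_l (q : quat) : q <> zero -> qinv q ** q = RtoQ 1.
Proof.
intros H. apply qdot_neq_0 in H. qcoord. repeat apply (f_equal2 pair); field; exact H.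
Qed.

Lemma qmult_1_l (q : quat) : RtoQ 1 ** q = q.
Proof. qring. Qed.

Lemma qmult_1_r (q : quat) : q ** RtoQ 1 = q.
Proof. qring. Qed.

Lemma q_ext (p q : quat) : (forall e, qdot e p = qdot e q) -> p = q.
Proof.
intros H.
assert (H0 := H (1, 0, 0, 0)). assert (H1 := H (0, 1, 0, 0)).
assert (H2 := H (0, 0, 1, 0)). assert (H3 := H (0, 0, 0, 1)).
clear H; qcoord. repeat apply (f_equal2 pair); lra.
Qed.

Lemma imag_unit_coord a b c d :
  imag_unit (a, b, c, d) <-> a = 0 /\ b ^ 2 + c ^ 2 + d ^ 2 = 1.
Proof.
unfold imag_unit; qcoord; split.
- intros H; injection H; intros.
  assert (a = 0) by nra. subst a; split; [reflexivity | lra].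
- intros [-> H]; repeat apply (f_equal2 pair); lra.
Qed.

Lemma imag_unit_conj (I p : quat) : p <> zero -> imag_unit I -> imag_unit (qinv p ** I ** p).
Proof.
intros Hp HI; unfold imag_unit in *.
replace (qinv p ** I ** p ** (qinv p ** I ** p))
  with (qinv p ** (I ** (p ** qinv p) ** I) ** p) by (rewrite !qmult_assoc; reflexivity).
rewrite qmult_qinv_r, qmult_1_r, HI by exact Hp.
replace (qinv p ** opp (RtoQ 1) ** p) with (opp (qinv p ** p)) by (generalize (qinv p); qring).
rewrite qmult_qinv_l by exact Hp; reflexivity.
Qed.

(** The adjoint of left multiplication by p is left multiplication by its
    conjugate. *)
Lemma qdot_qmult_r (e p q : quat) : qdot e (p ** q) = qdot (qconj p ** e) q.
Proof. qring. Qed.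

Lemma qdot_qmult_qmult (p q s : quat) : qdot (p ** q) (p ** s) = qdot p p * qdot q s.
Proof. qring. Qed.

Lemma qdot_opp_qmult (p e q : quat) : qdot (opp p ** e) q = - qdot (p ** e) q.
Proof. qring. Qed.

Lemma qconj_involutive (q : quat) : qconj (qconj q) = q.
Proof. qring. Qed.

Lemma qdot_conj_conj (p q : quat) : qdot (qconj p) (qconj q) = qdot p q.
Proof. qring. Qed.

Lemma qmult_opp_l (p q : quat) : opp p ** q = opp (p ** q).
Proof. qring. Qed.

Lemma imag_unit_qconj (K : quat) : imag_unit K -> qconj K = opp K.
Proof.
destruct K as [[[k0 k1] k2] k3]; intros [-> _]%imag_unit_coord. qring.
Qed.

Lemma imag_unit_qdot (K : quat) : imag_unit K -> qdot K K = 1.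
Proof.
destruct K as [[[k0 k1] k2] k3]; intros [-> H]%imag_unit_coord. qcoord. lra.
Qed.

Lemma imag_unit_sq (K q : quat) : imag_unit K -> K ** (K ** q) = opp q.
Proof.
intros H. rewrite <- qmult_assoc, H, qmult_opp_l, qmult_1_l. reflexivity.
Qed.

(** * A slice as a copy of the complex plane *)

(** The image of a complex number under the isomorphism i |-> K of the complex
    plane with the slice of K. *)
Definition to_slice (K : quat) (w : C) : quat := slice_pt K (Re w) (Im w).

(** A family of complex coordinates on the quaternions, indexed by e, which is
    linear over the slice of K acting by left multiplication. It turns a
    function regular on that slice into complex holomorphic functions without
    choosing a second unit orthogonal to K. *)
Definition slice_coord (K e q : quat) : C := (qdot e q, qdot (K ** e) q).

Lemma to_slice_qmult (K : quat) (w : C) (q : quat) :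
  to_slice K w ** q = plus (scal (Re w) q) (scal (Im w) (K ** q)).
Proof. unfold to_slice; generalize (Re w) (Im w); qring. Qed.

Lemma slice_coord_mult (K e : quat) (w : C) (q : quat) :
  imag_unit K -> slice_coord K e (to_slice K w ** q) = (w * slice_coord K e q)%C.
Proof.
intros HK; destruct w as [a b].
rewrite to_slice_qmult; unfold slice_coord; apply injective_projections; simpl;
  rewrite !qdot_plus_r, !qdot_scal_r.
- rewrite (qdot_qmult_r e K), imag_unit_qconj, qdot_opp_qmult by exact HK; ring.
- rewrite (qdot_qmult_qmult K), imag_unit_qdot by exact HK; ring.
Qed.

Lemma slice_coord_stem (K e b c : quat) :
  imag_unit K ->
  slice_coord K e (plus b (K ** c)) =
  ((qdot e b, qdot e c) + Ci * (qdot (K ** e) b, qdot (K ** e) c))%C.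
Proof.
intros HK; unfold slice_coord; apply injective_projections; simpl;
  rewrite qdot_plus_r.
- rewrite (qdot_qmult_r e K), imag_unit_qconj, qdot_opp_qmult by exact HK; ring.
- rewrite (qdot_qmult_qmult K), imag_unit_qdot by exact HK; ring.
Qed.

Lemma qdot_to_slice (K : quat) (w : C) :
  imag_unit K -> qdot (to_slice K w) (to_slice K w) = Cmod w ^ 2.
Proof.
destruct K as [[[k0 k1] k2] k3]; intros [-> H]%imag_unit_coord.
rewrite Cmod2_alt; unfold to_slice; generalize (Re w) (Im w); intros; qcoord.
replace (r0 ^ 2) with (r0 ^ 2 * (k1 ^ 2 + k2 ^ 2 + k3 ^ 2)) by (rewrite H; ring). ring.
Qed.

Lemma qnorm_slice_pt (K : quat) (x y : R) :
  imag_unit K -> qnorm (slice_pt K x y) = Cmod (x, y).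
Proof.
intros HK. change (slice_pt K x y) with (to_slice K (x, y)).
rewrite qnorm_sqrt, qdot_to_slice by exact HK. apply sqrt_pow2, Cmod_ge_0.
Qed.

Lemma slice_pt_surj (q : quat) :
  exists K x y, imag_unit K /\ q = slice_pt K x y.
Proof.
destruct q as [[[a b] c] d].
set (y := sqrt (b ^ 2 + c ^ 2 + d ^ 2)).
assert (Hy2 : y ^ 2 = b ^ 2 + c ^ 2 + d ^ 2) by (unfold y; rewrite pow2_sqrt; [ring | nra]).
destruct (Req_dec y 0) as [E | Hy].
- rewrite E in Hy2. exists (0, 1, 0, 0), a, 0; split; [apply imag_unit_coord; lra|].
  qcoord; repeat apply (f_equal2 pair); nra.
- exists (0, b / y, c / y, d / y), a, y; split.
  + apply imag_unit_coord; split; [reflexivity|].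
    replace ((b / y) ^ 2 + (c / y) ^ 2 + (d / y) ^ 2)
      with ((b ^ 2 + c ^ 2 + d ^ 2) / y ^ 2) by (field; exact Hy).
    rewrite <- Hy2; field; exact Hy.
  + qcoord; repeat apply (f_equal2 pair); field; exact Hy.
Qed.

(** * The symmetrization *)

(** For the value b + i c of a stem function in the complexified quaternions,
    this is the sum of the squares of its four complex coordinates, that is,
    its product with its quaternionic conjugate. It is the stem of the
    symmetrization of f and vanishes exactly when some b + J c does. *)
Definition symm (b c : quat) : C := (qdot b b - qdot c c, 2 * qdot b c).

Lemma symm_conj (b c : quat) : symm (qconj b) (qconj c) = symm b c.
Proof. unfold symm; rewrite !qdot_conj_conj; reflexivity. Qed.

(** The regular product of b + K c with its regular conjugate, evaluated on
    the slice of K: the slice scalars stay on the left, and b and c multiply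
    the conjugates from the left. *)
Lemma stem_mult_conj (K b c : quat) :
  imag_unit K ->
  let w := plus b (K ** c) in
  plus (w ** qconj b) (K ** (w ** qconj c)) = to_slice K (symm b c).
Proof.
intros HK w.
replace (to_slice K (symm b c)) with
  (plus (plus (b ** qconj b) (opp (c ** qconj c)))
     (K ** plus (c ** qconj b) (b ** qconj c)))
  by (unfold to_slice, symm; simpl; qring).
unfold w; rewrite !qmult_plus_l, !qmult_plus_r, !qmult_assoc.
rewrite (imag_unit_sq K) by exact HK.
generalize (b ** qconj b) (K ** (c ** qconj b)) (K ** (b ** qconj c)) (c ** qconj c).
qring.
Qed.

(** The symmetrization vanishes when |b| = |c| and b is orthogonal to c. Then
    J = - b c^(-1) has norm one and no real part, so it is an imaginary unit,
    and b + J c = 0. If c = 0, then b = 0 and any J will do. *)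
Lemma symm_zero_root (b c : quat) :
  symm b c = RtoC 0 -> exists J, imag_unit J /\ plus b (J ** c) = zero.
Proof.
intros H; injection H as H1 H2.
destruct (classic (c = zero)) as [-> | Hc].
- exists (0, 1, 0, 0); split; [apply imag_unit_coord; lra|].
  assert (Hb : b = zero).
  { apply qdot_eq_0. replace (qdot (zero : quat) zero) with 0 in H1 by qring. lra. }
  subst b; qring.
- assert (HN := qdot_neq_0 c Hc).
  exists (scal (- / qdot c c) (b ** qconj c)); split.
  + assert (E : qdot (b ** qconj c) (b ** qconj c) = qdot c c * qdot c c).
    { rewrite qdot_mult, qdot_conj_conj. replace (qdot b b) with (qdot c c) by lra. ring. }
    destruct (b ** qconj c) as [[[m0 m1] m2] m3] eqn:Em.
    assert (E0 : m0 = 0).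
    { assert (E0 : m0 = qdot b c).
      { replace m0 with (qdot (1, 0, 0, 0) (b ** qconj c)) by (rewrite Em; qring). qring. }
      lra. }
    rewrite qscalE; apply imag_unit_coord; split; [rewrite E0; ring|].
    rewrite E0 in E; unfold qdot in E at 1.
    replace ((- / qdot c c * m1) ^ 2 + (- / qdot c c * m2) ^ 2 + (- / qdot c c * m3) ^ 2)
      with ((0 * 0 + m1 * m1 + m2 * m2 + m3 * m3) / (qdot c c * qdot c c))
      by (field; exact HN).
    rewrite E; field; exact HN.
  + replace (scal (- / qdot c c) (b ** qconj c) ** c)
      with (opp (b ** (qinv c ** c))) by (unfold qinv; qring).
    rewrite qmult_qinv_l, qmult_1_r by exact Hc. qring.
Qed.

(** * From regular functions to holomorphic coordinates *)

(** Left Cauchy-Riemann equations on the slice of K, expressed through the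
    complex coordinates of the slice. *)
Definition slice_holomorphic_at (K : quat) (g : C -> quat) (x y : R) : Prop :=
  forall e, holomorphic_at (fun z => slice_coord K e (g z)) x y.

(** The pair (b, c) stands for the function b + i c with values in the
    complexified quaternions; each of its complex coordinates is required to
    be holomorphic. *)
Definition stem_holomorphic_at (b c : C -> quat) (x y : R) : Prop :=
  forall e, holomorphic_at (fun z => (qdot e (b z), qdot e (c z))) x y.

Lemma is_linear_Rlincomb {V : NormedModule R_AbsRing} (k : R) (f g : V -> R) :
  is_linear (f : V -> R_NormedModule) -> is_linear (g : V -> R_NormedModule) ->
  is_linear ((fun v => k * f v + g v) : V -> R_NormedModule).
Proof.
intros Hf Hg.
apply (is_linear_comp (W := R_NormedModule) (V := prod_NormedModule _ R_NormedModule R_NormedModule)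
  (fun v => (k * f v, g v)) (fun t => plus (fst t) (snd t))).
- apply is_linear_prod; [|exact Hg].
  apply (is_linear_comp (V := R_NormedModule) (W := R_NormedModule) f (fun t => scal k t) Hf).
  exact (is_linear_scal_r (K := R_AbsRing) (V := R_NormedModule) k Rmult_comm).
- apply is_linear_plus.
Qed.

Lemma is_linear_qdot (e : quat) : is_linear ((qdot e) : _ -> R_NormedModule).
Proof.
destruct e as [[[a b] c] d].
assert (L0 : is_linear ((fun q : quat => snd q) : _ -> R_NormedModule)) by apply is_linear_snd.
assert (L1 : is_linear ((fun q : quat => snd (fst q)) : _ -> R_NormedModule)).
{ apply (is_linear_comp (fun q : quat => fst q) snd); [apply is_linear_fst | apply is_linear_snd]. }
assert (L2 : is_linear ((fun q : quat => snd (fst (fst q))) : _ -> R_NormedModule)).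
{ apply (is_linear_comp (fun q : quat => fst (fst q)) snd); [|apply is_linear_snd].
  apply (is_linear_comp (fun q : quat => fst q) fst); apply is_linear_fst. }
assert (L3 : is_linear ((fun q : quat => fst (fst (fst q))) : _ -> R_NormedModule)).
{ apply (is_linear_comp (fun q : quat => fst (fst q)) fst); [|apply is_linear_fst].
  apply (is_linear_comp (fun q : quat => fst q) fst); apply is_linear_fst. }
apply is_linear_ext with (l1 := fun q : quat =>
  a * fst (fst (fst q)) + (b * snd (fst (fst q)) + (c * snd (fst q) + (d * snd q + 0)))).
{ intros [[[q0 q1] q2] q3]; simpl; ring. }
repeat (apply is_linear_Rlincomb; [assumption|]).
exact (is_linear_zero (V := R_NormedModule)).
Qed.

Lemma is_linear_slice (K : quat) :
  is_linear (fun z : R * R => slice_pt K (fst z) (snd z)).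
Proof.
apply is_linear_ext with (l1 := fun z : R * R =>
  plus (scal (fst z) (RtoQ 1)) (scal (snd z) K)).
{ intros [u v]; unfold slice_pt; simpl; qring. }
set (RR := prod_NormedModule R_AbsRing R_NormedModule R_NormedModule).
set (Q := prod_NormedModule R_AbsRing (prod_NormedModule R_AbsRing RR R_NormedModule) R_NormedModule).
apply (is_linear_comp (U := RR) (V := prod_NormedModule R_AbsRing Q Q) (W := Q)
  (fun z => (scal (fst z) (RtoQ 1 : Q), scal (snd z) (K : Q)))
  (fun t => plus (fst t) (snd t))); [|exact (is_linear_plus (V := Q))].
apply (is_linear_prod (T := RR) (U := Q) (V := Q)).
- apply (is_linear_comp (U := RR) (V := R_NormedModule) (W := Q)
    (fun z => fst z) (fun k => scal k (RtoQ 1 : Q)));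
   [exact (is_linear_fst (U := R_NormedModule) (V := R_NormedModule))
   | exact (is_linear_scal_l (K := R_AbsRing) (V := Q) (RtoQ 1 : Q))].
- apply (is_linear_comp (U := RR) (V := R_NormedModule) (W := Q)
    (fun z => snd z) (fun k => scal k (K : Q)));
   [exact (is_linear_snd (U := R_NormedModule) (V := R_NormedModule))
   | exact (is_linear_scal_l (K := R_AbsRing) (V := Q) (K : Q))].
Qed.

Lemma is_derive_qdot (e : quat) (h : R -> quat) (t : R) (l : quat) :
  is_derive h t l -> is_derive (fun u => qdot e (h u)) t (qdot e l).
Proof.
intros H.
refine (filterdiff_ext_lin _ _ _ (filterdiff_comp' h (qdot e) t _ _ H
   (filterdiff_linear _ (is_linear_qdot e))) _).
intros k; rewrite qdot_scal_r; reflexivity.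
Qed.

(** The differential of f composed with the slice is determined by the two
    partial derivatives along the slice. *)
Lemma slice_diff2 (f : quat -> quat) (K e : quat) (x y : R) (fx fy : quat) :
  ex_filterdiff f (locally (slice_pt K x y)) ->
  is_derive (fun t : R => f (slice_pt K t y)) x fx ->
  is_derive (fun t : R => f (slice_pt K x t)) y fy ->
  differentiable_pt_lim (fun u v => qdot e (f (slice_pt K u v))) x y
    (qdot e fx) (qdot e fy).
Proof.
intros [lf Hf] Hx Hy.
set (L := fun z : R * R => qdot e (lf (slice_pt K (fst z) (snd z)))).
assert (HD : filterdiff (fun z : R * R => qdot e (f (slice_pt K (fst z) (snd z))))
   (locally (x, y)) L).
{ apply (filterdiff_comp' (fun z : R * R => f (slice_pt K (fst z) (snd z))) (qdot e) (x, y)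
     (fun z => lf (slice_pt K (fst z) (snd z)))).
  - apply (filterdiff_comp' (fun z : R * R => slice_pt K (fst z) (snd z)) f (x, y)).
    + apply filterdiff_linear, is_linear_slice.
    + exact Hf.
  - apply filterdiff_linear, is_linear_qdot. }
assert (HL : is_linear (L : R * R -> R_NormedModule)) by apply HD.
assert (HD' : differentiable_pt_lim (fun u v => qdot e (f (slice_pt K u v))) x y
  (L (1, 0)) (L (0, 1))).
{ apply filterdiff_differentiable_pt_lim.
  apply (filterdiff_ext_lin _ _ _ HD).
  intros [u v]; simpl fst; simpl snd.
  replace ((u, v) : R * R) with (plus (scal u (1, 0) : R * R) (scal v (0, 1) : R * R)).
  - rewrite (linear_plus _ HL), !(linear_scal _ HL). reflexivity.
  - unfold plus, scal; simpl; unfold mult, prod_plus, prod_scal, plus, scal; simpl; unfold mult; simpl.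
    f_equal; ring. }
destruct (differentiable_pt_lim_unique _ _ _ _ _ HD') as [E1 E2].
replace (qdot e fx) with (L (1, 0))
  by (rewrite <- E1; exact (is_derive_unique _ _ _ (is_derive_qdot e _ _ _ Hx))).
replace (qdot e fy) with (L (0, 1))
  by (rewrite <- E2; exact (is_derive_unique _ _ _ (is_derive_qdot e _ _ _ Hy))).
exact HD'.
Qed.

Lemma qdot_zero_r (e : quat) : qdot e zero = 0.
Proof. qring. Qed.

Lemma qdot_opp_r (e p : quat) : qdot e (opp p) = - qdot e p.
Proof. qring. Qed.

Lemma qscal_half_eq_0 (p : quat) : scal (1 / 2) p = zero -> p = zero.
Proof.
intros H; apply q_ext; intros e; apply (f_equal (qdot e)) in H.
rewrite qdot_scal_r, qdot_zero_r in H. rewrite qdot_zero_r; lra.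
Qed.

Lemma qplus_opp_eq (p q : quat) : plus p (opp q) = zero -> p = q.
Proof.
intros H; apply q_ext; intros e; apply (f_equal (qdot e)) in H.
rewrite qdot_plus_r, qdot_opp_r, qdot_zero_r in H; lra.
Qed.

Lemma regular_slice_holo (Omega : quat -> Prop) (f : quat -> quat) (K : quat) (x y : R) :
  regular Omega f -> imag_unit K -> Omega (slice_pt K x y) ->
  slice_holomorphic_at K (fun z => f (to_slice K z)) x y.
Proof.
intros [Hd Hr] HK HO e.
destruct (Hr K HK x y HO) as (fx & fy & Hx & Hy & HCR).
assert (Efy : fy = K ** fx).
{ apply qscal_half_eq_0 in HCR.
  assert (E : K ** plus fx (K ** fy) = zero) by (rewrite HCR; qring).
  rewrite qmult_plus_r, imag_unit_sq in E by exact HK.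
  symmetry; apply qplus_opp_eq, E. }
subst fy.
exists (qdot e fx), (qdot (K ** e) fx); split.
- eapply diff2_eq; [exact (slice_diff2 f K e x y _ _ (Hd _ HO) Hx Hy) | reflexivity |].
  rewrite (qdot_qmult_r e K), imag_unit_qconj, qdot_opp_qmult by exact HK; reflexivity.
- eapply diff2_eq; [exact (slice_diff2 f K (K ** e) x y _ _ (Hd _ HO) Hx Hy) | reflexivity |].
  rewrite (qdot_qmult_qmult K), imag_unit_qdot by exact HK; ring.
Qed.

(** * The stem function and the representation formula *)

(** The Schwarz reflection of F in the real axis. *)
Lemma holo_reflect (F : C -> C) x y :
  holomorphic_at F x (- y) -> holomorphic_at (fun z => Cconj (F (Cconj z))) x y.
Proof.
intros (p & q & H1 & H2); exists p, (- q).
assert (Ha : differentiable_pt_lim (fun u v => u) x y 1 0).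
{ apply diff2_ext with (fun u v => 1 * u + 0 * v + 0); [apply diff2_affine | intros; ring]. }
assert (Hb : differentiable_pt_lim (fun u v => - v) x y 0 (-1)).
{ apply diff2_ext with (fun u v => 0 * u + -1 * v + 0); [apply diff2_affine | intros; ring]. }
assert (K1 := differentiable_pt_lim_comp (fun u v => Re (F (u, v))) (fun u v => u) (fun u v => - v)
  x y _ _ _ _ _ _ H1 Ha Hb).
assert (K2 := differentiable_pt_lim_comp (fun u v => Im (F (u, v))) (fun u v => u) (fun u v => - v)
  x y _ _ _ _ _ _ H2 Ha Hb).
split.
- eapply diff2_eq; [exact K1 | ring | ring].
- eapply diff2_eq.
  + eapply diff2_ext; [exact (diff2_lincomb (-1) 0 _ _ _ _ _ _ _ _ K2 Ha)|].
    intros u v; unfold Cconj, Re, Im; simpl; ring.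
  + ring.
  + ring.
Qed.

Lemma slice_holo_stem (K : quat) (b c : C -> quat) x y :
  imag_unit K -> stem_holomorphic_at b c x y -> slice_holomorphic_at K (fun z => plus (b z) (K ** c z)) x y.
Proof.
intros HK H e.
apply holo_ext with (fun z => (qdot e (b z), qdot e (c z))
   + Ci * (qdot (K ** e) (b z), qdot (K ** e) (c z)))%C.
- intros z; rewrite slice_coord_stem by exact HK; reflexivity.
- apply holo_plus; [apply H | apply holo_scal, H].
Qed.

Lemma stem_holo_conj (b c : C -> quat) x y :
  stem_holomorphic_at b c x y -> stem_holomorphic_at (fun z => qconj (b z)) (fun z => qconj (c z)) x y.
Proof.
intros H e. apply holo_ext with (2 := H (qconj e)).
intros z; rewrite !qdot_conj_r; reflexivity.
Qed.

Lemma symm_holo (b c : C -> quat) x y :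
  stem_holomorphic_at b c x y -> holomorphic_at (fun z => symm (b z) (c z)) x y.
Proof.
intros H.
apply holo_ext with (fun z =>
   (qdot (1, 0, 0, 0) (b z), qdot (1, 0, 0, 0) (c z)) ^ 2
 + ((qdot (0, 1, 0, 0) (b z), qdot (0, 1, 0, 0) (c z)) ^ 2
 + ((qdot (0, 0, 1, 0) (b z), qdot (0, 0, 1, 0) (c z)) ^ 2
 + (qdot (0, 0, 0, 1) (b z), qdot (0, 0, 0, 1) (c z)) ^ 2)))%C.
- intros z; unfold symm; destruct (b z) as [[[? ?] ?] ?], (c z) as [[[? ?] ?] ?].
  apply injective_projections; simpl; ring.
- repeat apply holo_plus; apply holo_pow, H.
Qed.

Definition unit_i : quat := (0, 1, 0, 0).

Lemma imag_unit_i : imag_unit unit_i.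
Proof. apply imag_unit_coord; lra. Qed.

(** The stem function is read off on the slice of the unit i, from the values
    of f at z and at its conjugate; the representation formula says that every
    other slice gives the same result. *)
Definition stem_re (f : quat -> quat) (z : C) : quat :=
  scal (1 / 2) (plus (f (to_slice unit_i z)) (f (to_slice unit_i (Cconj z)))).

Definition stem_im (f : quat -> quat) (z : C) : quat :=
  scal (1 / 2) (unit_i ** plus (f (to_slice unit_i (Cconj z))) (opp (f (to_slice unit_i z)))).

Lemma regular_disc_holo (r : R) (f : quat -> quat) (K : quat) (x y : R) :
  regular (qball r) f -> imag_unit K -> Cmod (x, y) < r ->
  slice_holomorphic_at K (fun z => f (to_slice K z)) x y.
Proof.
intros Hf HK Hxy. apply (regular_slice_holo (qball r)); [exact Hf | exact HK |].
unfold qball; rewrite qnorm_slice_pt by exact HK; exact Hxy.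
Qed.

(** Each complex coordinate of the stem function is the average of a
    holomorphic coordinate of f on the slice of i and of its Schwarz
    reflection. *)
Lemma stem_holo_regular (r : R) (f : quat -> quat) (x y : R) :
  regular (qball r) f -> Cmod (x, y) < r -> stem_holomorphic_at (stem_re f) (stem_im f) x y.
Proof.
intros Hf Hxy e.
set (Phi := fun z => slice_coord unit_i e (f (to_slice unit_i z))).
apply holo_ext with (fun z => RtoC (1 / 2) * (Phi z + Cconj (Phi (Cconj z))))%C.
- intros z; unfold stem_re, stem_im, Phi, slice_coord.
  apply injective_projections; unfold Cmult, Cplus, Cconj, RtoC; cbn [fst snd];
    rewrite qdot_scal_r, ?(qdot_qmult_r e unit_i), ?qdot_plus_r.
  + unfold Rdiv; ring.
  + rewrite imag_unit_qconj, !qdot_opp_qmult, qdot_opp_r by exact imag_unit_i.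
    unfold Rdiv; ring.
- apply holo_scal, holo_plus.
  + apply (regular_disc_holo r); [exact Hf | exact imag_unit_i | exact Hxy].
  + apply holo_reflect.
    apply (regular_disc_holo r); [exact Hf | exact imag_unit_i |].
    change (x, - y) with (Cconj (x, y)); rewrite Cmod_conj; exact Hxy.
Qed.

Lemma stem_re_conj f z : stem_re f (Cconj z) = stem_re f z.
Proof.
unfold stem_re; rewrite Cconj_conj.
generalize (f (to_slice unit_i (Cconj z))) (f (to_slice unit_i z)); intros p q.
apply q_ext; intros e; rewrite !qdot_scal_r, !qdot_plus_r; ring.
Qed.

Lemma stem_im_conj f z : stem_im f (Cconj z) = opp (stem_im f z).
Proof.
unfold stem_im; rewrite Cconj_conj.
generalize (f (to_slice unit_i (Cconj z))) (f (to_slice unit_i z)); intros p q.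
apply q_ext; intros e; rewrite qdot_opp_r, !qdot_scal_r, !(qdot_qmult_r e), !qdot_plus_r, !qdot_opp_r; ring.
Qed.

(** Both sides are holomorphic on the slice of K in the coordinates
    slice_coord, and they agree on the real axis, where they both reduce to f.
    *)
Theorem representation_formula (r : R) (f : quat -> quat) (K : quat) (x y : R) :
  regular (qball r) f -> imag_unit K -> Cmod (x, y) < r ->
  f (slice_pt K x y) = plus (stem_re f (x, y)) (K ** stem_im f (x, y)).
Proof.
intros Hf HK Hxy.
change (slice_pt K x y) with (to_slice K (x, y)).
apply q_ext; intros e.
set (D := fun z => (slice_coord K e (f (to_slice K z))
  + RtoC (-1) * slice_coord K e (plus (stem_re f z) (K ** stem_im f z)))%C).
assert (E : D (x, y) = RtoC 0).
{ apply (holo_zero_of_axis D r); [| | exact Hxy].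
  - intros u v Huv. apply holo_plus; [|apply holo_scal].
    + apply (regular_disc_holo r); assumption.
    + apply slice_holo_stem; [exact HK|]. apply (stem_holo_regular r); assumption.
  - intros u _; unfold D.
    replace (plus (stem_re f (u, 0)) (K ** stem_im f (u, 0))) with (f (to_slice K (u, 0))).
    + generalize (slice_coord K e (f (to_slice K (u, 0)))); intros w; ring.
    + assert (Ec : forall I, to_slice I (u, 0) = RtoQ u) by (intros I; unfold to_slice; simpl; qring).
      assert (E0 : Cconj (u, 0) = (u, 0)) by (unfold Cconj; simpl; f_equal; ring).
      unfold stem_re, stem_im; rewrite E0, !Ec.
      apply q_ext; intros e'. rewrite qdot_plus_r, (qdot_qmult_r e' K), !qdot_scal_r.
      rewrite (qdot_qmult_r _ unit_i), !qdot_plus_r, qdot_opp_r. field. }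
apply (f_equal Re) in E; unfold D, slice_coord in E; simpl in E. lra.
Qed.

(** * Continuity of quaternion-valued functions *)

Definition qcontinuous_at (g : C -> quat) (x y : R) : Prop :=
  forall e, continuity_2d_pt (fun u v => qdot e (g (u, v))) x y.

Lemma slice_holo_continuous (K : quat) (g : C -> quat) x y : slice_holomorphic_at K g x y -> qcontinuous_at g x y.
Proof. intros H e. apply (holo_continuous _ _ _ (H e)). Qed.

Lemma qcont_const (q : quat) x y : qcontinuous_at (fun _ => q) x y.
Proof. intros e; apply continuity_2d_pt_const. Qed.

Lemma qcont_conj g x y : qcontinuous_at g x y -> qcontinuous_at (fun z => qconj (g z)) x y.
Proof.
intros H e; apply continuity_2d_pt_ext with (2 := H (qconj e)).
intros; symmetry; apply qdot_conj_r.
Qed.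

Lemma qcont_scal (h : C -> R) g x y :
  continuity_2d_pt (fun u v => h (u, v)) x y -> qcontinuous_at g x y ->
  qcontinuous_at (fun z => scal (h z) (g z)) x y.
Proof.
intros Hh Hg e.
apply continuity_2d_pt_ext with (2 := continuity_2d_pt_mult _ _ _ _ Hh (Hg e)).
intros; symmetry; apply qdot_scal_r.
Qed.

Lemma qcont_plus g h x y : qcontinuous_at g x y -> qcontinuous_at h x y -> qcontinuous_at (fun z => plus (g z) (h z)) x y.
Proof.
intros Hg Hh e.
apply continuity_2d_pt_ext with (2 := continuity_2d_pt_plus _ _ _ _ (Hg e) (Hh e)).
intros; symmetry; apply qdot_plus_r.
Qed.

Lemma continuity_2d_qdot g h x y :
  qcontinuous_at g x y -> qcontinuous_at h x y -> continuity_2d_pt (fun u v => qdot (g (u, v)) (h (u, v))) x y.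
Proof.
intros Hg Hh.
assert (K := fun e => continuity_2d_pt_mult _ _ _ _ (Hg e) (Hh e)).
eapply continuity_2d_pt_ext; [|
  exact (continuity_2d_pt_plus _ _ _ _ (K (1, 0, 0, 0)) (continuity_2d_pt_plus _ _ _ _
   (K (0, 1, 0, 0)) (continuity_2d_pt_plus _ _ _ _ (K (0, 0, 1, 0)) (K (0, 0, 0, 1)))))].
intros u v; cbv beta; clear K; generalize (g (u, v)) (h (u, v)); qring.
Qed.

Lemma qcont_mult g h x y : qcontinuous_at g x y -> qcontinuous_at h x y -> qcontinuous_at (fun z => g z ** h z) x y.
Proof.
intros Hg Hh e.
assert (K := fun e' => continuity_2d_pt_mult _ _ _ _ (Hg e') (Hh (qconj e' ** e))).
eapply continuity_2d_pt_ext; [|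
  exact (continuity_2d_pt_plus _ _ _ _ (K (1, 0, 0, 0)) (continuity_2d_pt_plus _ _ _ _
   (K (0, 1, 0, 0)) (continuity_2d_pt_plus _ _ _ _ (K (0, 0, 1, 0)) (K (0, 0, 0, 1)))))].
intros u v; cbv beta; clear K; generalize (g (u, v)) (h (u, v)); qring.
Qed.

Lemma qcont_inv g x y : g (x, y) <> zero -> qcontinuous_at g x y -> qcontinuous_at (fun z => qinv (g z)) x y.
Proof.
intros Hn Hg. apply (qcont_scal (fun z => / qdot (g z) (g z))); [|apply qcont_conj, Hg].
apply continuity_2d_pt_inv; [apply continuity_2d_qdot; exact Hg | apply qdot_neq_0, Hn].
Qed.

Lemma qcont_locally (g : C -> quat) x y (P : quat -> Prop) :
  qcontinuous_at g x y -> locally (g (x, y)) P -> locally_2d (fun u v => P (g (u, v))) x y.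
Proof.
intros Hg [eps HP].
generalize (Hg (1, 0, 0, 0) eps) (Hg (0, 1, 0, 0) eps) (Hg (0, 0, 1, 0) eps) (Hg (0, 0, 0, 1) eps).
intros H0 H1 H2 H3.
assert (H := locally_2d_and _ _ _ _ (locally_2d_and _ _ _ _ H0 H1) (locally_2d_and _ _ _ _ H2 H3)).
clear H0 H1 H2 H3.
apply locally_2d_impl with (2 := H), locally_2d_forall; clear H.
intros u v [[H0 H1] [H2 H3]]; apply HP.
destruct (g (x, y)) as [[[a b] c] d], (g (u, v)) as [[[a' b'] c'] d'].
unfold qdot in *.
repeat split; unfold ball; simpl; unfold AbsRing_ball, abs, minus, plus, opp; simpl.
- replace (a' + - a) with (1 * a' + 0 * b' + 0 * c' + 0 * d' - (1 * a + 0 * b + 0 * c + 0 * d)) by ring; exact H0.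
- replace (b' + - b) with (0 * a' + 1 * b' + 0 * c' + 0 * d' - (0 * a + 1 * b + 0 * c + 0 * d)) by ring; exact H1.
- replace (c' + - c) with (0 * a' + 0 * b' + 1 * c' + 0 * d' - (0 * a + 0 * b + 1 * c + 0 * d)) by ring; exact H2.
- replace (d' + - d) with (0 * a' + 0 * b' + 0 * c' + 1 * d' - (0 * a + 0 * b + 0 * c + 1 * d)) by ring; exact H3.
Qed.

(** * Values of the regular reciprocal *)

Lemma to_slice_mult (K : quat) (w w' : C) (q : quat) :
  imag_unit K -> to_slice K w ** (to_slice K w' ** q) = to_slice K (w * w')%C ** q.
Proof.
intros HK; apply q_ext; intros e.
assert (E : slice_coord K e (to_slice K w ** (to_slice K w' ** q)) = slice_coord K e (to_slice K (w * w')%C ** q)).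
{ rewrite !slice_coord_mult by exact HK; ring. }
exact (f_equal Re E).
Qed.

Lemma to_slice_1 (K q : quat) : to_slice K (RtoC 1) ** q = q.
Proof. rewrite to_slice_qmult; simpl; qring. Qed.

(** The product of f and its regular conjugate f^c is the symmetrization f^s,
    but the second factor is evaluated at the point whose imaginary unit is
    the conjugate J of K by f^c(z). Therefore the regular reciprocal f^c / f^s
    at a point of the slice of K has norm 1 / |f(x + y J)|. *)
Lemma conj_stem_mult_value (K J b c : quat) :
  imag_unit K ->
  let P := plus (qconj b) (K ** qconj c) in
  K ** P = P ** J -> P ** plus b (J ** c) = to_slice K (symm b c).
Proof.
intros HK P HJ.
rewrite <- symm_conj, <- (stem_mult_conj K (qconj b) (qconj c)) by exact HK.
fold P; rewrite !qconj_involutive, qmult_plus_r, <- (qmult_assoc K), HJ, qmult_assoc.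
reflexivity.
Qed.

Lemma qmult_cancel_l (w p q : quat) : w <> zero -> w ** p = w ** q -> p = q.
Proof.
intros Hw H.
rewrite <- (qmult_1_l p), <- (qmult_1_l q), <- (qmult_qinv_l w), !qmult_assoc, H by exact Hw.
reflexivity.
Qed.

Lemma conjugate_intertwine (p q : quat) : p <> zero -> p ** (qinv p ** q ** p) = q ** p.
Proof.
intros Hp. rewrite <- !qmult_assoc, qmult_qinv_r, qmult_1_l by exact Hp. reflexivity.
Qed.

(** This selects the slice on which to look at the regular reciprocal: with K
    = w^(-1) I w and w = f(x + y I), the twisted unit at the given point is I
    itself, so that the reciprocal sees the value of f at the minimum point.
    *)
Lemma conj_stem_intertwines (I b c : quat) :
  imag_unit I ->
  let w := plus b (I ** c) in
  let K := qinv w ** I ** w in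
  let P := plus (qconj b) (K ** qconj c) in
  w <> zero -> K ** P = P ** I.
Proof.
intros HI w K P Hw.
assert (HwK : w ** K = I ** w) by (apply conjugate_intertwine, Hw).
assert (HwP : w ** P = to_slice I (symm b c)).
{ rewrite <- stem_mult_conj by exact HI. fold w.
  unfold P; rewrite qmult_plus_r, <- !qmult_assoc, HwK. reflexivity. }
apply (qmult_cancel_l w); [exact Hw|].
rewrite <- !qmult_assoc, HwK, qmult_assoc, HwP.
unfold to_slice; generalize (Re (symm b c)) (Im (symm b c)); qring.
Qed.

Lemma qdot_sq_minus (p q : quat) :
  qdot (plus p (opp q)) (plus p (opp q)) = qdot p p - 2 * qdot p q + qdot q q.
Proof. qring. Qed.

(** * The minimum principle *)

(** The regular conjugate f^c on the slice of K. *)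
Definition conj_on_slice (K : quat) (f : quat -> quat) (z : C) : quat :=
  plus (qconj (stem_re f z)) (K ** qconj (stem_im f z)).

Definition symm_stem (f : quat -> quat) (z : C) : C := symm (stem_re f z) (stem_im f z).

Lemma conj_on_slice_holo (r : R) (f : quat -> quat) (K : quat) x y :
  regular (qball r) f -> imag_unit K -> Cmod (x, y) < r ->
  slice_holomorphic_at K (conj_on_slice K f) x y.
Proof.
intros Hf HK Hxy. apply slice_holo_stem; [exact HK|].
apply stem_holo_conj, (stem_holo_regular r); assumption.
Qed.

Lemma symm_stem_holo (r : R) (f : quat -> quat) x y :
  regular (qball r) f -> Cmod (x, y) < r -> holomorphic_at (symm_stem f) x y.
Proof. intros Hf Hxy. apply symm_holo, (stem_holo_regular r); assumption. Qed.

Lemma holo_neq0_locally (F : C -> C) x y :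
  holomorphic_at F x y -> F (x, y) <> RtoC 0 -> locally_2d (fun u v => F (u, v) <> RtoC 0) x y.
Proof.
intros HF Hn. destruct (holo_continuous F x y HF) as [H1 H2].
assert (HN := C_normsq_neq0 _ Hn).
apply locally_2d_impl with (2 := continuity_2d_pt_neq_0
  (fun u v => Re (F (u, v)) * Re (F (u, v)) + Im (F (u, v)) * Im (F (u, v))) x y
  (continuity_2d_pt_plus _ _ _ _ (continuity_2d_pt_mult _ _ _ _ H1 H1)
    (continuity_2d_pt_mult _ _ _ _ H2 H2)) HN).
apply locally_2d_forall; intros u v H E; apply H; rewrite E; simpl; ring.
Qed.

Lemma conj_on_slice_norm (r : R) (f : quat -> quat) (K J : quat) x y :
  regular (qball r) f -> imag_unit K -> imag_unit J -> Cmod (x, y) < r ->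
  K ** conj_on_slice K f (x, y) = conj_on_slice K f (x, y) ** J ->
  qdot (conj_on_slice K f (x, y)) (conj_on_slice K f (x, y))
    * qdot (f (slice_pt J x y)) (f (slice_pt J x y)) = Cmod (symm_stem f (x, y)) ^ 2.
Proof.
intros Hf HK HJ Hxy HKJ.
rewrite <- qdot_mult, (representation_formula r) by assumption.
unfold conj_on_slice in *; rewrite conj_stem_mult_value by assumption.
apply qdot_to_slice, HK.
Qed.

(** On the slice of the twisted unit K, the norm of the regular reciprocal g
    of f at z is 1 / |f(x + y J(z))|, where J(z) is continuous and J = I at
    the given point. A local minimum of |f| is thus a local maximum of |g|,
    with value a at the maximum point. Near it <a, g> <= |a|^2, with equality
    at the point; as <a, g> is the real part of a holomorphic function, it is
    constant, which together with |g| <= |a| gives g = a. The conclusion is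
    written without division, as f^c = f^s a, so that it makes sense on the
    whole disc. *)
Lemma reciprocal_locally_constant (r : R) (f : quat -> quat) (x y : R) (I : quat) :
  regular (qball r) f -> imag_unit I -> Cmod (x, y) < r ->
  locally (slice_pt I x y) (fun q => qnorm (f (slice_pt I x y)) <= qnorm (f q)) ->
  f (slice_pt I x y) <> zero -> symm_stem f (x, y) <> RtoC 0 ->
  exists K a, imag_unit K /\ a <> zero /\
    locally_2d (fun u v => conj_on_slice K f (u, v) = to_slice K (symm_stem f (u, v)) ** a) x y.
Proof.
intros Hf HI Hxy Hmin Hw Hs.
set (w := f (slice_pt I x y)) in *.
set (K := qinv w ** I ** w).
assert (HK : imag_unit K) by (apply imag_unit_conj; assumption).
set (P := conj_on_slice K f). set (s := symm_stem f) in *.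
(* The minimum point is seen by the reciprocal at the same (x, y). *)
assert (HP0 : K ** P (x, y) = P (x, y) ** I).
{ assert (Ew := representation_formula r f I x y Hf HI Hxy); fold w in Ew.
  unfold P, conj_on_slice, K; rewrite Ew.
  apply conj_stem_intertwines; [exact HI | rewrite <- Ew; exact Hw]. }
clearbody K.
assert (HN0 : qdot (P (x, y)) (P (x, y)) * qdot w w = Cmod (s (x, y)) ^ 2)
  by (apply (conj_on_slice_norm r f K I); assumption).
assert (Hs0 : 0 < Cmod (s (x, y))) by (apply Cmod_gt_0, Hs).
assert (HPn : P (x, y) <> zero).
{ intros E; rewrite E in HN0. rewrite qdot_zero_r, Rmult_0_l in HN0. nra. }
assert (HPc : qcontinuous_at P x y)
  by (apply slice_holo_continuous with K, (conj_on_slice_holo r); assumption).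
set (J := fun z => qinv (P z) ** K ** P z).
assert (HJ0 : J (x, y) = I).
{ unfold J; rewrite qmult_assoc, HP0, <- qmult_assoc, qmult_qinv_l, qmult_1_l by exact HPn.
  reflexivity. }
assert (HJc : qcontinuous_at J x y).
{ unfold J; repeat apply qcont_mult; try exact HPc; [|apply qcont_const].
  apply qcont_inv; assumption. }
(* The points x + y J(z) tend to the minimum point, so the minimality of |f|
   applies to them although J(z) varies. *)
assert (Hlocmin : locally_2d (fun u v => qnorm w <= qnorm (f (slice_pt (J (u, v)) u v))) x y).
{ apply (qcont_locally (fun z => slice_pt (J z) (Re z) (Im z)) x y
    (fun q => qnorm w <= qnorm (f q))).
  - unfold slice_pt; apply qcont_plus.
    + intros e. apply continuity_2d_pt_ext with (fun u v => u * qdot e (RtoQ 1)).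
      * intros u v; simpl; qring.
      * apply continuity_2d_pt_mult; [apply continuity_2d_pt_id1 | apply continuity_2d_pt_const].
    + apply qcont_scal; [apply continuity_2d_pt_id2 | exact HJc].
  - simpl; rewrite HJ0; exact Hmin. }
assert (HPl : locally_2d (fun u v => P (u, v) <> zero) x y).
{ apply locally_2d_impl with (2 := continuity_2d_pt_neq_0 _ _ _
    (continuity_2d_qdot P P x y HPc HPc) (qdot_neq_0 _ HPn)), locally_2d_forall.
  intros u v H E; apply H; rewrite E; apply qdot_zero_r. }
assert (Hsl := holo_neq0_locally s x y (symm_stem_holo r f x y Hf Hxy) Hs).
assert (Hloc := locally_2d_and _ _ _ _ (locally_2d_and _ _ _ _ Hlocmin HPl)
  (locally_2d_and _ _ _ _ Hsl (locally_2d_disc r x y Hxy))).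
set (g := fun z => to_slice K (/ s z)%C ** P z).
set (a := g (x, y)).
assert (Hw2 : 0 < qdot w w).
{ generalize (qdot_ge_0 w) (qdot_neq_0 w Hw); lra. }
assert (Hgn : forall z, s z <> RtoC 0 ->
   qdot (g z) (g z) * Cmod (s z) ^ 2 = qdot (P z) (P z)).
{ intros z Hz; unfold g; rewrite qdot_mult, qdot_to_slice, Cmod_inv by assumption.
  field. apply Rgt_not_eq, Cmod_gt_0, Hz. }
assert (Ha : qdot a a * qdot w w = 1).
{ specialize (Hgn _ Hs); fold a in Hgn. rewrite <- Hgn in HN0.
  apply Rmult_eq_reg_r with (Cmod (s (x, y)) ^ 2); [|nra]. lra. }
assert (Hgle : locally_2d (fun u v => qdot (g (u, v)) (g (u, v)) <= qdot a a) x y).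
{ apply locally_2d_impl with (2 := Hloc), locally_2d_forall.
  intros u v [[H1 H2] [H3 H4]].
  assert (HJu : imag_unit (J (u, v))) by (apply imag_unit_conj; assumption).
  assert (E := conj_on_slice_norm r f K (J (u, v)) u v Hf HK HJu H4
    (eq_sym (conjugate_intertwine _ K H2))).
  fold P s in E. rewrite <- (Hgn _ H3) in E.
  assert (Hc : 0 < Cmod (s (u, v))) by (apply Cmod_gt_0, H3).
  set (w' := f (slice_pt (J (u, v)) u v)) in *.
  assert (E' : qdot (g (u, v)) (g (u, v)) * qdot w' w' = 1).
  { apply Rmult_eq_reg_r with (Cmod (s (u, v)) ^ 2); [lra | nra]. }
  assert (Hle : qdot w w <= qdot w' w').
  { rewrite !qnorm_sqrt in H1. apply sqrt_le_0; [apply qdot_ge_0 | apply qdot_ge_0 | exact H1]. }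
  generalize (qdot_ge_0 (g (u, v))); nra. }
assert (Hga : locally_2d (fun u v => g (u, v) = a) x y).
{ set (F := fun z => (/ s z * slice_coord K a (P z))%C).
  assert (HRe : forall z, Re (F z) = qdot a (g z)).
  { intros z; unfold F; rewrite <- slice_coord_mult by exact HK; reflexivity. }
  assert (HF : locally_2d (fun u v => holomorphic_at F u v /\ Re (F (u, v)) <= Re (F (x, y))) x y).
  { apply locally_2d_impl with (2 := locally_2d_and _ _ _ _ Hloc Hgle), locally_2d_forall.
    intros u v [[_ [H3 H4]] H5]; split.
    - apply holo_mult.
      + apply holo_inv; [exact H3 | apply (symm_stem_holo r); assumption].
      + apply (conj_on_slice_holo r f K u v Hf HK H4).
    - rewrite !HRe; fold a.
      assert (H6 := qdot_ge_0 (plus a (opp (g (u, v))))).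
      rewrite qdot_sq_minus in H6; lra. }
  apply holo_re_max in HF.
  apply locally_2d_impl with (2 := locally_2d_and _ _ _ _ HF Hgle), locally_2d_forall.
  intros u v [H1 H2]; rewrite !HRe in H1; fold a in H1.
  symmetry; apply qplus_opp_eq, qdot_eq_0.
  apply Rle_antisym; [|apply qdot_ge_0]. rewrite qdot_sq_minus; lra. }
exists K, a; split; [exact HK | split].
- intros E; rewrite E, qdot_zero_r in Ha; lra.
- apply locally_2d_impl with (2 := locally_2d_and _ _ _ _ Hga Hsl), locally_2d_forall.
  intros u v [H1 H2]; fold P s; rewrite <- H1; unfold g.
  rewrite to_slice_mult, Cinv_r, to_slice_1 by assumption; reflexivity.
Qed.

Lemma symm_opp (b c : quat) : symm b (opp c) = Cconj (symm b c).
Proof. unfold symm, Cconj; cbn [fst snd]; apply (f_equal2 pair); qring. Qed.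

Lemma symm_scal (w : C) (a : quat) :
  symm (scal (Re w) a) (scal (Im w) a) = (w * w * RtoC (qdot a a))%C.
Proof.
destruct w as [s0 s1]; unfold symm, Cmult, RtoC, Re, Im; cbn [fst snd].
apply (f_equal2 pair); qring.
Qed.

Lemma qmult_qconj_opp (p q : quat) : p ** qconj (opp q) = opp (p ** qconj q).
Proof. qring. Qed.

Lemma qmult_scal_r (k : R) (p q : quat) : p ** scal k q = scal k (p ** q).
Proof. qring. Qed.

(** The relation f^c = f^s a extends to the whole disc by the identity
    theorem. A single equation on the slice does not separate the two parts of
    the stem, but comparing it at z and at the conjugate of z does, the first
    parts being even and the second odd in the imaginary part. *)
Lemma stem_of_constant_reciprocal (r : R) (f : quat -> quat) (K a : quat) (x y : R) :
  regular (qball r) f -> imag_unit K -> Cmod (x, y) < r ->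
  locally_2d (fun u v => conj_on_slice K f (u, v) = to_slice K (symm_stem f (u, v)) ** a) x y ->
  forall u v, Cmod (u, v) < r ->
    qconj (stem_re f (u, v)) = scal (Re (symm_stem f (u, v))) a /\
    qconj (stem_im f (u, v)) = scal (Im (symm_stem f (u, v))) a.
Proof.
intros Hf HK Hxy Hloc.
assert (Hall : forall u v, Cmod (u, v) < r ->
  conj_on_slice K f (u, v) = to_slice K (symm_stem f (u, v)) ** a).
{ intros u v Huv; apply q_ext; intros e.
  set (D := fun z => (slice_coord K e (conj_on_slice K f z) + RtoC (-1) * (symm_stem f z * slice_coord K e a))%C).
  assert (E : D (u, v) = RtoC 0).
  { apply (holo_identity D r x y u v); try assumption.
    - intros s t Hst; apply holo_plus; [apply (conj_on_slice_holo r); assumption|].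
      apply holo_scal, holo_mult; [apply (symm_stem_holo r); assumption | apply holo_const].
    - apply locally_2d_impl with (2 := Hloc), locally_2d_forall.
      intros s t E; unfold D; rewrite E, slice_coord_mult by exact HK.
      ring. }
  unfold D in E; rewrite <- slice_coord_mult in E by exact HK.
  revert E; generalize (conj_on_slice K f (u, v)) (to_slice K (symm_stem f (u, v)) ** a).
  intros p q E; apply (f_equal Re) in E; simpl in E; lra. }
intros u v Huv.
assert (E1 := Hall u v Huv).
assert (E2 := Hall u (- v)). change (u, - v) with (Cconj (u, v)) in E2.
rewrite Cmod_conj in E2; specialize (E2 Huv).
unfold conj_on_slice, symm_stem in E1, E2.
rewrite stem_re_conj, stem_im_conj in E2.
unfold symm_stem.
set (b := stem_re f (u, v)) in *. set (c := stem_im f (u, v)) in *.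
rewrite symm_opp in E2; rewrite to_slice_qmult in E1, E2.
replace (Re (Cconj (symm b c))) with (Re (symm b c)) in E2 by reflexivity.
replace (Im (Cconj (symm b c))) with (- Im (symm b c)) in E2 by reflexivity.
set (s0 := Re (symm b c)) in *. set (s1 := Im (symm b c)) in *.
assert (Hb : forall e, qdot e (qconj b) = qdot e (scal s0 a) /\
   qdot e (K ** qconj c) = qdot e (K ** scal s1 a)).
{ intros e. apply (f_equal (qdot e)) in E1, E2.
  rewrite qmult_qconj_opp in E2; rewrite qmult_scal_r.
  rewrite !qdot_plus_r, ?qdot_opp_r, !qdot_scal_r in *. lra. }
split.
- apply q_ext; intros e; apply Hb.
- apply (qmult_cancel_l K).
  + intros E. apply imag_unit_qdot in HK. rewrite E, qdot_zero_r in HK; lra.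
  + apply q_ext; intros e; apply Hb.
Qed.

(** Since f^c = f^s a holds for the stems, taking symmetrizations gives f^s =
    (f^s)^2 |a|^2. Hence f^s equals the constant 1 / |a|^2 wherever it is
    nonzero, in particular near the given point, and then everywhere by the
    identity theorem. So f^c is constant, and f with it. *)
Lemma constant_of_constant_reciprocal (r : R) (f : quat -> quat) (K a : quat) (x y : R) :
  regular (qball r) f -> imag_unit K -> a <> zero -> Cmod (x, y) < r ->
  symm_stem f (x, y) <> RtoC 0 ->
  locally_2d (fun u v => conj_on_slice K f (u, v) = to_slice K (symm_stem f (u, v)) ** a) x y ->
  exists c, forall q, qball r q -> f q = c.
Proof.
intros Hf HK Ha Hxy Hs Hloc.
assert (Hstem := stem_of_constant_reciprocal r f K a x y Hf HK Hxy Hloc).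
assert (Ha2 := qdot_neq_0 a Ha).
set (k := / qdot a a).
assert (Hquad : forall u v, Cmod (u, v) < r ->
  (symm_stem f (u, v) = symm_stem f (u, v) * symm_stem f (u, v) * RtoC (qdot a a))%C).
{ intros u v Huv; destruct (Hstem u v Huv) as [Hb Hc].
  unfold symm_stem at 1; rewrite <- symm_conj, Hb, Hc.
  apply symm_scal. }
assert (Hk : forall u v, Cmod (u, v) < r -> symm_stem f (u, v) = RtoC k).
{ intros u v Huv.
  assert (E : (symm_stem f (u, v) + RtoC (- k))%C = RtoC 0).
  { apply (holo_identity (fun z => symm_stem f z + RtoC (- k))%C r x y); try assumption.
    - intros s t Hst; apply holo_plus; [apply (symm_stem_holo r); assumption | apply holo_const].
    - apply locally_2d_impl with (2 := locally_2d_and _ _ _ _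
        (holo_neq0_locally _ _ _ (symm_stem_holo r f x y Hf Hxy) Hs) (locally_2d_disc r x y Hxy)).
      apply locally_2d_forall; intros s t [H1 H2].
      assert (Hq := Hquad s t H2). set (S := symm_stem f (s, t)) in *.
      assert (E1 : (S * RtoC (qdot a a))%C = RtoC 1).
      { replace (S * RtoC (qdot a a))%C with (/ S * (S * S * RtoC (qdot a a)))%C
          by (field; exact H1).
        rewrite <- Hq; field; exact H1. }
      replace S with (S * RtoC (qdot a a) * RtoC k)%C.
      + rewrite E1; rewrite RtoC_opp; ring.
      + rewrite <- Cmult_assoc, <- RtoC_mult.
        replace (qdot a a * k) with 1 by (unfold k; field; exact Ha2). ring. }
  replace (symm_stem f (u, v)) with (symm_stem f (u, v) + RtoC (- k) + RtoC k)%C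
    by (rewrite RtoC_opp; ring).
  rewrite E; ring. }
exists (scal k (qconj a)); intros q Hq.
destruct (slice_pt_surj q) as (J & u & v & HJ & ->).
unfold qball in Hq; rewrite qnorm_slice_pt in Hq by exact HJ.
rewrite (representation_formula r) by assumption.
destruct (Hstem u v Hq) as [Hb Hc]; rewrite (Hk u v Hq) in Hb, Hc.
apply (f_equal qconj) in Hb, Hc; rewrite qconj_involutive in Hb, Hc.
rewrite Hb, Hc; change (Re (RtoC k)) with k; change (Im (RtoC k)) with 0.
generalize k a J; clear; qring.
Qed.

Theorem theorem4p3 (r : R) (hr : 0 < r) (f : quat -> quat)
    (hf : regular (qball r) f)
    (x y : R) (I : quat) (hI : imag_unit I)
    (hp : qball r (slice_pt I x y))
    (hmin : locally (slice_pt I x y)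
              (fun q : quat => qnorm (f (slice_pt I x y)) <= qnorm (f q))) :
  (exists c : quat, forall q : quat, qball r q -> f q = c) \/
  (exists q : quat, qsphere x y q /\ f q = zero).
Proof.
assert (Hxy : Cmod (x, y) < r)
  by (unfold qball in hp; rewrite qnorm_slice_pt in hp; assumption).
destruct (classic (f (slice_pt I x y) = zero)) as [H0 | H0].
{ right; exists (slice_pt I x y); split; [exists I; auto | exact H0]. }
destruct (classic (symm_stem f (x, y) = RtoC 0)) as [Hs | Hs].
- right. destruct (symm_zero_root _ _ Hs) as (J & HJ & E).
  exists (slice_pt J x y); split; [exists J; auto|].
  rewrite (representation_formula r) by assumption; exact E.
- left.
  destruct (reciprocal_locally_constant r f x y I hf hI Hxy hmin H0 Hs)
    as (K & a & HK & Ha & Hloc).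
  exact (constant_of_constant_reciprocal r f K a x y hf HK Ha Hxy Hs Hloc).
Qed.
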